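(* The symmetric bar recursor $\mathsf{sBR}$ is primitive recursively definable from Spector's bar recursor $\mathsf{BR}$, provably in $\mathsf{E\text{-}HA}^\omega+\mathsf{sBI}+\mathsf{BR}$: for all types $X,R$ there is a term $\Gamma$ of Gödel's system $\mathsf{T}$ extended by constants $\mathsf{BR}$ (of suitable types) such that $\mathsf{E\text{-}HA}^\omega+\mathsf{sBI}+\mathsf{BR}$ proves that for all $\phi\colon X^\dagger\to(X\to R)\to R$, $b\colon X^\dagger\to R$, $\varphi\colon X^{\mathbb{N}}\to\mathbb{N}$ and $u\colon X^\dagger$, $$\Gamma^{\phi,b,\varphi}(u)=\begin{cases}b(u)&\text{if }\varphi(\hat u)\in\mathrm{dom}(u),\\ \phi(u)\big(\lambda x^X.\,\Gamma^{\phi,b,\varphi}(u\oplus(\varphi(\hat u),x))\big)&\text{otherwise.}\end{cases}$$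
   Context: $\mathsf{E\text{-}HA}^\omega$ is extensional Heyting arithmetic in all finite types (full induction, $\lambda$-abstraction, primitive recursors; quantifier-free fragment Gödel's system $\mathsf{T}$). $X^*$: finite sequences over $X$, $|s|$ length, $\hat s\colon X^{\mathbb{N}}$ extension by the canonical element $\mathbf{0}_X$. $X^\dagger$: finite partial functions from $\mathbb{N}$ to $X$ with decidable finite domain $\mathrm{dom}(u)$; $\emptyset$ the nowhere-defined one; $\hat u\colon X^{\mathbb{N}}$ agrees with $u$ on $\mathrm{dom}(u)$ and is $\mathbf{0}_X$ elsewhere; $\hat\varphi(u):=\varphi(\hat u)$; $u\oplus(n,x)$ equals $u$ if $n\in\mathrm{dom}(u)$ and otherwise is $u$ extended with value $x$ at $n$. $\mathsf{BR}$ adds, for all types $Z,S$, constants $\mathsf{BR}_{Z,S}$ with defining equation: for $\phi\colon Z^*\to(Z\to S)\to S$, $b\colon Z^*\to S$, $\varphi\colon Z^{\mathbb{N}}\to\mathbb{N}$, $s\colon Z^*$: $\mathsf{BR}^{\phi,b,\varphi}(s)=b(s)$ if $\varphi(\hat s)<|s|$, and $=\phi(s)(\lambda z.\mathsf{BR}^{\phi,b,\varphi}(s*\langle z\rangle))$ otherwise. The displayed equation is the defining equation of $\mathsf{sBR}_{X,R}$. $\mathsf{sBI}$ is the schema (all types $X$, all formulas $P$ on $X^\dagger$): $\forall\varphi\big(\forall\alpha\exists n P([\alpha]^{\varphi}_{n})\wedge\forall u(S_\varphi(u)\to([\varphi(\hat u)\notin\mathrm{dom}(u)\to\forall x P(u\oplus(\varphi(\hat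 u),x))]\to P(u)))\to P(\emptyset)\big)$. Here $[\alpha]^{\varphi}_{0}=\emptyset$, $[\alpha]^{\varphi}_{i+1}=[\alpha]^{\varphi}_{i}\oplus(m_i,\alpha(m_i))$ with $m_i=\hat\varphi([\alpha]^{\varphi}_{i})$; for $u\colon X^\dagger$, $[u]^{\varphi}_{0}=\emptyset$, $[u]^{\varphi}_{i+1}=[u]^{\varphi}_{i}\oplus(n_i,u(n_i))$ if $n_i\in\mathrm{dom}(u)$ and $[u]^{\varphi}_{i}$ otherwise, with $n_i=\hat\varphi([u]^{\varphi}_{i})$; and $S_\varphi(u)$ means $u=[u]^{\varphi}_{|\mathrm{dom}(u)|}$. *)

(* Defs.v *)
From Stdlib Require Import List.
Import ListNotations.

Inductive ty : Type :=
| TNat : ty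
| Arr  : ty -> ty -> ty
| Prod : ty -> ty -> ty
| Seq  : ty -> ty.            (* [Seq X] is X^* *)

Notation "A ~> B" := (Arr A B) (at level 55, right associativity).

Definition Strm (X : ty) : ty := TNat ~> X.

(** X^dagger, the finite partial functions from N to X, is the type of lists
    over N * X read through the bijective coding
      [(k_0,x_0); ...; (k_l,x_l)]  codes the u with domain n_0 < ... < n_l and
      u(n_i) = x_i,  where  n_0 = k_0  and  n_{i+1} = n_i + 1 + k_{i+1}.
    Every list codes exactly one finite partial function and conversely, so the
    equality, the variables and the quantifiers of this type are those of
    X^dagger, and |dom(u)| is the length of the list. *)
Definition Part (X : ty) : ty := Seq (Prod TNat X).

(** The common shape of the types of the bar recursors; D is the type of the
    positions (X^* or X^dagger), X the type of the moves and R that of results. *)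
Definition BarRecTy (D X R : ty) : ty :=
  (D ~> (X ~> R) ~> R) ~> (D ~> R) ~> (Strm X ~> TNat) ~> D ~> R.

Definition ctx := list ty.

Inductive var : ctx -> ty -> Type :=
| VZ : forall G A, var (A :: G) A
| VS : forall G A B, var G A -> var (B :: G) A.
Arguments VZ {G A}.
Arguments VS {G A B} _.

(** The constants of system T with product and sequence types, and BR. *)
Inductive const : ty -> Type :=
| Zero : const TNat
| Succ : const (TNat ~> TNat)
| Pair : forall A B, const (A ~> B ~> Prod A B)
| Fst  : forall A B, const (Prod A B ~> A)
| Snd  : forall A B, const (Prod A B ~> B)
| Nil  : forall A, const (Seq A)
| Cons : forall A, const (A ~> Seq A ~> Seq A)
| Rec  : forall A, const (A ~> (TNat ~> A ~> A) ~> TNat ~> A)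
| SRec : forall A B, const (B ~> (A ~> Seq A ~> B ~> B) ~> Seq A ~> B)
| BR   : forall Z S, const (BarRecTy (Seq Z) Z S).
Arguments Pair {A B}.
Arguments Fst {A B}.
Arguments Snd {A B}.
Arguments Nil {A}.
Arguments Cons {A}.
Arguments Rec {A}.
Arguments SRec {A B}.

(** [tm nil A] is thus the set of closed terms of type A of Gödel's T extended
    by the constants BR_{Z,S} for all types Z, S. *)
Inductive tm (G : ctx) : ty -> Type :=
| Var : forall A, var G A -> tm G A
| Con : forall A, const A -> tm G A
| App : forall A B, tm G (A ~> B) -> tm G A -> tm G B
| Lam : forall A B, tm (A :: G) B -> tm G (A ~> B).
Arguments Var {G A} _.
Arguments Con {G A} _.
Arguments App {G A B} _ _.
Arguments Lam {G A B} _.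

Notation "t $ s" := (App t s) (at level 25, left associativity).

Notation v0 := (Var VZ).
Notation v1 := (Var (VS VZ)).
Notation v2 := (Var (VS (VS VZ))).
Notation v3 := (Var (VS (VS (VS VZ)))).
Notation v4 := (Var (VS (VS (VS (VS VZ))))).

Definition rmap (G D : ctx) := forall A, var G A -> var D A.
Definition smap (G D : ctx) := forall A, var G A -> tm D A.

Definition vcase {G : ctx} {B : ty} {P : ty -> Type}
    (z : P B) (s : forall A, var G A -> P A) (A : ty) (x : var (B :: G) A) : P A :=
  match x in var G' A' return
    match G' with
    | [] => unit
    | B' :: G'' => P B' -> (forall C, var G'' C -> P C) -> P A'
    end
  with
  | VZ => fun z _ => z
  | VS y => fun _ s => s _ y
  end z s.

Definition rlift {G D : ctx} (B : ty) (r : rmap G D) : rmap (B :: G) (B :: D) :=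
  vcase (P := var (B :: D)) VZ (fun A x => VS (r A x)).

Fixpoint ren {G D : ctx} {A : ty} (t : tm G A) (r : rmap G D) : tm D A :=
  match t with
  | Var x => Var (r _ x)
  | Con c => Con c
  | App f a => App (ren f r) (ren a r)
  | Lam b => Lam (ren b (rlift _ r))
  end.

Definition wk {G : ctx} {A : ty} (B : ty) (t : tm G A) : tm (B :: G) A :=
  ren t (fun _ x => VS x).

Definition scons {G D : ctx} {B : ty} (t : tm D B) (s : smap G D) : smap (B :: G) D :=
  vcase (P := tm D) t s.

Definition slift {G D : ctx} (B : ty) (s : smap G D) : smap (B :: G) (B :: D) :=
  scons v0 (fun A x => wk B (s A x)).

Fixpoint sub {G D : ctx} {A : ty} (t : tm G A) (s : smap G D) : tm D A :=
  match t with
  | Var x => s _ x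
  | Con c => Con c
  | App f a => App (sub f s) (sub a s)
  | Lam b => Lam (sub b (slift _ s))
  end.

Definition inst {G : ctx} {A B : ty} (b : tm (A :: G) B) (a : tm G A) : tm G B :=
  sub b (scons a (fun _ x => Var x)).

Definition novar {D : ctx} : rmap [] D :=
  fun A x => match x in var G A return match G with [] => var D A | _ => unit end with
             | VZ => tt
             | VS _ => tt
             end.

Definition closed {D : ctx} {A : ty} (t : tm [] A) : tm D A := ren t novar.

(** Equality is primitive at every type; [EHA] below makes it a congruence and
    extensional. *)
Inductive fm (G : ctx) : Type :=
| Eq  : forall A, tm G A -> tm G A -> fm G
| Bot : fm G
| And : fm G -> fm G -> fm G
| Or  : fm G -> fm G -> fm G
| Imp : fm G -> fm G -> fm G
| All : forall A, fm (A :: G) -> fm G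
| Ex  : forall A, fm (A :: G) -> fm G.
Arguments Eq {G A} _ _.
Arguments Bot {G}.
Arguments And {G} _ _.
Arguments Or {G} _ _.
Arguments Imp {G} _ _.
Arguments All {G} A _.
Arguments Ex {G} A _.

Definition Neg {G : ctx} (P : fm G) : fm G := Imp P Bot.

Fixpoint fsub {G D : ctx} (P : fm G) (s : smap G D) : fm D :=
  match P with
  | Eq t u => Eq (sub t s) (sub u s)
  | Bot => Bot
  | And P Q => And (fsub P s) (fsub Q s)
  | Or P Q => Or (fsub P s) (fsub Q s)
  | Imp P Q => Imp (fsub P s) (fsub Q s)
  | All A P => All A (fsub P (slift A s))
  | Ex A P => Ex A (fsub P (slift A s))
  end.

(** [fat P r a] is P(a), the parameters of P being renamed along [r]. *)
Definition fat {G D : ctx} {A : ty} (P : fm (A :: G)) (r : rmap G D) (a : tm D A) : fm D :=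
  fsub P (scons a (fun _ x => Var (r _ x))).

Definition finst {G : ctx} {A : ty} (P : fm (A :: G)) (a : tm G A) : fm G :=
  fat P (fun _ x => x) a.

Definition fwk {G : ctx} (B : ty) (P : fm G) : fm (B :: G) :=
  fsub P (fun _ x => Var (VS x)).

Set Implicit Arguments.

Definition theory := forall G : ctx, fm G -> Prop.

(** [prv T Hs P]: natural deduction in the typed context [G] of free variables. *)
Inductive prv (T : theory) : forall G : ctx, list (fm G) -> fm G -> Prop :=
| p_ax   : forall G (Hs : list (fm G)) P, T G P -> prv T Hs P
| p_hyp  : forall G (Hs : list (fm G)) P, In P Hs -> prv T Hs P
| p_botE : forall G (Hs : list (fm G)) P, prv T Hs Bot -> prv T Hs P
| p_andI : forall G (Hs : list (fm G)) P Q, prv T Hs P -> prv T Hs Q -> prv T Hs (And P Q)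
| p_andL : forall G (Hs : list (fm G)) P Q, prv T Hs (And P Q) -> prv T Hs P
| p_andR : forall G (Hs : list (fm G)) P Q, prv T Hs (And P Q) -> prv T Hs Q
| p_orL  : forall G (Hs : list (fm G)) P Q, prv T Hs P -> prv T Hs (Or P Q)
| p_orR  : forall G (Hs : list (fm G)) P Q, prv T Hs Q -> prv T Hs (Or P Q)
| p_orE  : forall G (Hs : list (fm G)) P Q C,
    prv T Hs (Or P Q) -> prv T (P :: Hs) C -> prv T (Q :: Hs) C -> prv T Hs C
| p_impI : forall G (Hs : list (fm G)) P Q, prv T (P :: Hs) Q -> prv T Hs (Imp P Q)
| p_impE : forall G (Hs : list (fm G)) P Q, prv T Hs (Imp P Q) -> prv T Hs P -> prv T Hs Q
| p_allI : forall G (Hs : list (fm G)) A (P : fm (A :: G)),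
    prv T (map (fwk A) Hs) P -> prv T Hs (All A P)
| p_allE : forall G (Hs : list (fm G)) A (P : fm (A :: G)) (a : tm G A),
    prv T Hs (All A P) -> prv T Hs (finst P a)
| p_exI  : forall G (Hs : list (fm G)) A (P : fm (A :: G)) (a : tm G A),
    prv T Hs (finst P a) -> prv T Hs (Ex A P)
| p_exE  : forall G (Hs : list (fm G)) A (P : fm (A :: G)) C,
    prv T Hs (Ex A P) -> prv T (P :: map (fwk A) Hs) (fwk A C) -> prv T Hs C.

Definition provable (T : theory) (P : fm []) : Prop := prv T [] P.

Inductive tunion (T U : theory) : theory :=
| in_left  : forall G (P : fm G), T G P -> tunion T U P
| in_right : forall G (P : fm G), U G P -> tunion T U P.

Inductive EHA : theory :=
| ax_refl : forall G A (t : tm G A), EHA (Eq t t)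
| ax_leib : forall G A (P : fm (A :: G)) (t u : tm G A),
    EHA (Imp (Eq t u) (Imp (finst P t) (finst P u)))
| ax_beta : forall G A B (b : tm (A :: G) B) (a : tm G A),
    EHA (Eq (Lam b $ a) (inst b a))
| ax_ext : forall G A B (f g : tm G (A ~> B)),
    EHA (Imp (All A (Eq (wk A f $ v0) (wk A g $ v0))) (Eq f g))
| ax_fst : forall G A B (a : tm G A) (b : tm G B), EHA (Eq (Con Fst $ (Con Pair $ a $ b)) a)
| ax_snd : forall G A B (a : tm G A) (b : tm G B), EHA (Eq (Con Snd $ (Con Pair $ a $ b)) b)
| ax_pair : forall G A B (p : tm G (Prod A B)),
    EHA (Eq (Con Pair $ (Con Fst $ p) $ (Con Snd $ p)) p)
| ax_S_neq_0 : forall G (n : tm G TNat), EHA (Neg (Eq (Con Succ $ n) (Con Zero)))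
| ax_S_inj : forall G (m n : tm G TNat),
    EHA (Imp (Eq (Con Succ $ m) (Con Succ $ n)) (Eq m n))
| ax_ind : forall G (P : fm (TNat :: G)),
    EHA (Imp (finst P (Con Zero))
        (Imp (All TNat (Imp P (fat P (fun _ x => VS x) (Con Succ $ v0))))
             (All TNat P)))
| ax_rec_0 : forall G A (a : tm G A) f,
    EHA (Eq (Con Rec $ a $ f $ Con Zero) a)
| ax_rec_S : forall G A (a : tm G A) f n,
    EHA (Eq (Con Rec $ a $ f $ (Con Succ $ n)) (f $ n $ (Con Rec $ a $ f $ n)))
| ax_sind : forall G A (P : fm (Seq A :: G)),
    EHA (Imp (finst P (Con Nil))
        (Imp (All A (All (Seq A)
               (Imp (fat P (fun _ x => VS (VS x)) v0)
                    (fat P (fun _ x => VS (VS x)) (Con Cons $ v1 $ v0)))))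
             (All (Seq A) P)))
| ax_srec_nil : forall G A B (b : tm G B) (f : tm G (A ~> Seq A ~> B ~> B)),
    EHA (Eq (Con SRec $ b $ f $ Con Nil) b)
| ax_srec_cons : forall G A B (b : tm G B) (f : tm G (A ~> Seq A ~> B ~> B)) x s,
    EHA (Eq (Con SRec $ b $ f $ (Con Cons $ x $ s)) (f $ x $ s $ (Con SRec $ b $ f $ s))).

(** The canonical element 0_A. *)
Fixpoint can {G : ctx} (A : ty) : tm G A :=
  match A return tm G A with
  | TNat => Con Zero
  | Arr A B => Lam (ren (can (G := G) B) (fun _ x => VS x))
  | Prod A B => Con Pair $ can A $ can B
  | Seq A => Con Nil
  end.

Definition predT {G : ctx} : tm G (TNat ~> TNat) :=
  Con Rec $ Con Zero $ Lam (Lam v1).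

(** truncated subtraction m - n *)
Definition monusT {G : ctx} : tm G (TNat ~> TNat ~> TNat) :=
  Lam (Lam (Con Rec $ v1 $ Lam (Lam (predT $ v0)) $ v0)).

Definition monus {G : ctx} (m n : tm G TNat) : tm G TNat := monusT $ m $ n.

(** [ite c t e]: e if c = 0, and t otherwise *)
Definition iteT {G : ctx} {A : ty} : tm G (TNat ~> A ~> A ~> A) :=
  Lam (Lam (Lam (Con Rec $ v0 $ Lam (Lam v3) $ v2))).

Definition ite {G : ctx} {A : ty} (c : tm G TNat) (t e : tm G A) : tm G A :=
  iteT $ c $ t $ e.

(** comparison of n and k, with [lt] the result if n < k, etc *)
Definition cmp {G : ctx} {A : ty} (n k : tm G TNat) (lt eq gt : tm G A) : tm G A :=
  ite (monus k n) lt (ite (monus n k) gt eq).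

Definition Lt {G : ctx} (m n : tm G TNat) : fm G :=
  Eq (monus (Con Succ $ m) n) (Con Zero).

(** |s|, the extension of s : Z^* by 0_Z to an infinite sequence, s * <z> *)

Definition lenT {G : ctx} {Z : ty} : tm G (Seq Z ~> TNat) :=
  Con SRec $ Con Zero $ Lam (Lam (Lam (Con Succ $ v0))).

Definition len {G : ctx} {Z : ty} (s : tm G (Seq Z)) : tm G TNat := lenT $ s.

Definition shatT {G : ctx} {Z : ty} : tm G (Seq Z ~> Strm Z) :=
  Con SRec $ Lam (can Z)
           $ Lam (Lam (Lam (* x s r *) (Lam (* n *)
               (Con Rec $ v3 $ Lam (* m *) (Lam (v3 $ v1)) $ v0)))).

Definition shat {G : ctx} {Z : ty} (s : tm G (Seq Z)) : tm G (Strm Z) := shatT $ s.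

Definition snocT {G : ctx} {Z : ty} : tm G (Seq Z ~> Z ~> Seq Z) :=
  Lam (Lam (* s z *)
    (Con SRec $ (Con Cons $ v0 $ Con Nil)
              $ Lam (Lam (Lam (* x s' r *) (Con Cons $ v2 $ v0)))
              $ v1)).

Definition snoc {G : ctx} {Z : ty} (s : tm G (Seq Z)) (z : tm G Z) : tm G (Seq Z) :=
  snocT $ s $ z.

(** In the three recursions below, the head (k,x) of u is v3 or v4, k being the
    least element of the domain; the tail is (the code of) u shifted by k + 1. *)

(** characteristic function of dom(u) *)
Definition domT {G : ctx} {X : ty} : tm G (Part X ~> TNat ~> TNat) :=
  Con SRec $ Lam (Con Zero)
           $ Lam (Lam (Lam (* (k,x) u r *) (Lam (* n *)
               (cmp v0 (Con Fst $ v3)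
                  (Con Zero)
                  (Con Succ $ Con Zero)
                  (v1 $ (predT $ monus v0 (Con Fst $ v3))))))).

Definition domc {G : ctx} {X : ty} (u : tm G (Part X)) (n : tm G TNat) : tm G TNat :=
  domT $ u $ n.

Definition InDom {G : ctx} {X : ty} (n : tm G TNat) (u : tm G (Part X)) : fm G :=
  Eq (domc u n) (Con Succ $ Con Zero).

(** the total extension of u by 0_X; it also provides u(n) for n in dom(u) *)
Definition phatT {G : ctx} {X : ty} : tm G (Part X ~> Strm X) :=
  Con SRec $ Lam (can X)
           $ Lam (Lam (Lam (* (k,x) u r *) (Lam (* n *)
               (cmp v0 (Con Fst $ v3)
                  (can X)
                  (Con Snd $ v3)
                  (v1 $ (predT $ monus v0 (Con Fst $ v3))))))).

Definition phat {G : ctx} {X : ty} (u : tm G (Part X)) : tm G (Strm X) := phatT $ u.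

(** u (+) (n,x) *)
Definition updT {G : ctx} {X : ty} : tm G (Part X ~> TNat ~> X ~> Part X) :=
  Con SRec $ Lam (Lam (* n x *) (Con Cons $ (Con Pair $ v1 $ v0) $ Con Nil))
           $ Lam (Lam (Lam (* (k,y) u r *) (Lam (Lam (* n x *)
               (cmp v1 (Con Fst $ v4)
                  (Con Cons $ (Con Pair $ v1 $ v0)
                    $ (Con Cons $ (Con Pair $ (predT $ monus (Con Fst $ v4) v1) $ (Con Snd $ v4))
                                $ v3))
                  (Con Cons $ v4 $ v3)
                  (Con Cons $ v4 $ (v2 $ (predT $ monus v1 (Con Fst $ v4)) $ v0))))))).

Definition upd {G : ctx} {X : ty} (u : tm G (Part X)) (n : tm G TNat) (x : tm G X)
  : tm G (Part X) := updT $ u $ n $ x.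

(** [alpha]^phi_n for alpha : X^N *)
Definition segT {G : ctx} {X : ty} : tm G ((Strm X ~> TNat) ~> Strm X ~> TNat ~> Part X) :=
  Lam (Lam (* phi alpha *)
    (Con Rec $ Con Nil
             $ Lam (Lam (* i v *) (upd v0 (v3 $ phat v0) (v2 $ (v3 $ phat v0)))))).

Definition seg {G : ctx} {X : ty} (phi : tm G (Strm X ~> TNat)) (alpha : tm G (Strm X))
  (n : tm G TNat) : tm G (Part X) := segT $ phi $ alpha $ n.

(** [u]^phi_n for u : X^dagger *)
Definition psegT {G : ctx} {X : ty} : tm G ((Strm X ~> TNat) ~> Part X ~> TNat ~> Part X) :=
  Lam (Lam (* phi u *)
    (Con Rec $ Con Nil
             $ Lam (Lam (* i v *)
                 (ite (domc v2 (v3 $ phat v0))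
                      (upd v0 (v3 $ phat v0) (phat v2 $ (v3 $ phat v0)))
                      v0)))).

Definition pseg {G : ctx} {X : ty} (phi : tm G (Strm X ~> TNat)) (u : tm G (Part X))
  (n : tm G TNat) : tm G (Part X) := psegT $ phi $ u $ n.

(** S_phi(u) *)
Definition Sgood {G : ctx} {X : ty} (phi : tm G (Strm X ~> TNat)) (u : tm G (Part X)) : fm G :=
  Eq u (pseg phi u (len u)).

Definition EqCases {G : ctx} {A : ty} (t : tm G A) (C : fm G) (a b : tm G A) : fm G :=
  And (Imp C (Eq t a)) (Imp (Neg C) (Eq t b)).

(** The four bound variables are phi, b, varphi and the position s or u
    (v3, v2, v1, v0; shifted by one under the inner [Lam]). *)

Definition BR_eqn (Z S : ty) {G : ctx} : fm G :=
  All (Seq Z ~> (Z ~> S) ~> S) (All (Seq Z ~> S) (All (Strm Z ~> TNat) (All (Seq Z)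
    (EqCases (Con (BR Z S) $ v3 $ v2 $ v1 $ v0)
       (Lt (v1 $ shat v0) (len v0))
       (v2 $ v0)
       (v3 $ v0 $ Lam (Con (BR Z S) $ v4 $ v3 $ v2 $ snoc v1 v0)))))).

Definition sBR_eqn (X R : ty) (t : tm [] (BarRecTy (Part X) X R)) {G : ctx} : fm G :=
  All (Part X ~> (X ~> R) ~> R) (All (Part X ~> R) (All (Strm X ~> TNat) (All (Part X)
    (EqCases (closed t $ v3 $ v2 $ v1 $ v0)
       (InDom (v1 $ phat v0) v0)
       (v2 $ v0)
       (v3 $ v0 $ Lam (closed t $ v4 $ v3 $ v2 $ upd v1 (v2 $ phat v1) v0)))))).

(** P may have further free variables, those of [G]. *)
Definition sBI_fm {G : ctx} (X : ty) (P : fm (Part X :: G)) : fm G :=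
  All (Strm X ~> TNat)
    (Imp
      (And
        (All (Strm X) (Ex TNat (fat P (fun _ x => VS (VS (VS x))) (seg v2 v1 v0))))
        (All (Part X)
          (Imp (Sgood v1 v0)
            (Imp (Imp (Neg (InDom (v1 $ phat v0) v0))
                      (All X (fat P (fun _ x => VS (VS (VS x))) (upd v1 (v2 $ phat v1) v0))))
                 (fat P (fun _ x => VS (VS x)) v0)))))
      (fat P (fun _ x => VS x) (Con Nil))).

Inductive BR_ax : theory :=
| BR_intro : forall G Z S, BR_ax (BR_eqn Z S (G := G)).

Inductive sBI_ax : theory :=
| sBI_intro : forall G X (P : fm (Part X :: G)), sBI_ax (sBI_fm P).

Definition EHA_sBI_BR : theory := tunion (tunion EHA sBI_ax) BR_ax.

(* Main.v *)
(** Spector's BR, at type nat, is first used as an unbounded search.  Fix phi, a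
    starting position u and answers beta, and let V_0 = u and
    V_{i+1} = V_i (+) (phi(V_i^), beta_i); V_i is stopped if phi(V_i^) is in dom(V_i).
    A sequence s of numbers is read as the guess that a position j < |s| is ever
    filled only if it is filled in V_{s_0 + ... + s_j}.  The bar recursion extends
    the guess first by 0, and then by the stage that it got back, until phi of the
    guessed limit stream is below |s|.  What comes back is a stage that is stopped
    or refutes a guess of s; at the empty s nothing is left to refute.  The values
    of the recursion bound its depth, so induction on them replaces bar induction.

    Given this search, the symmetric recursor from u on is BR over the sequence s
    of the values played since u, with the search as control.  That playing x from
    u is the same as starting at u (+) (phi(u^),x) is an equality of two solutions
    of one recursion, and follows by sBI for the functional that lets the
    starting position override its argument. *)
From Stdlib Require Import List Setoid Morphisms.
Require Import Defs.
Import ListNotations.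

(** * Substitution *)

(** The context of [x] is an index of its type, so the match binds [Q] afresh in the branch for
    non-empty contexts. All later arguments on substitutions under a binder split variables this
    way. *)
Lemma vcaseP {G B} (Q : forall A, var (B :: G) A -> Prop) :
  Q B VZ -> (forall A (x : var G A), Q A (VS x)) -> forall A (x : var (B :: G) A), Q A x.
Proof.
  intros z s A x.
  refine (match x as x' in var G' A' return
    match G' as G0 return forall A0, var G0 A0 -> Prop with
    | [] => fun _ _ => True
    | B' :: G'' => fun A0 x0 => forall Q : (forall A, var (B' :: G'') A -> Prop),
        Q B' VZ -> (forall A (x : var G'' A), Q A (VS x)) -> Q A0 x0
    end A' x' with
  | VZ => _ | VS y => _ end Q z s); intros; auto.
Qed.

Lemma var_nil {A} (P : Prop) (x : var [] A) : P.
Proof. exact (match x in var G _ return match G with [] => P | _ => True end with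
  VZ => I | VS _ => I end). Qed.

Lemma ren_ext {G A} (t : tm G A) D (r r' : rmap G D) :
  (forall B x, r B x = r' B x) -> ren t r = ren t r'.
Proof.
  revert D r r'; induction t; intros D r r' H; cbn; f_equal; auto.
  apply IHt. refine (vcaseP _ _ _); cbn; intros; f_equal; auto.
Qed.

Lemma sub_ext {G A} (t : tm G A) D (s s' : smap G D) :
  (forall B x, s B x = s' B x) -> sub t s = sub t s'.
Proof.
  revert D s s'; induction t; intros D r r' H; cbn; f_equal; auto.
  apply IHt. refine (vcaseP _ _ _); cbn; intros; unfold wk; rewrite ?H; auto.
Qed.

Lemma fsub_ext {G} (P : fm G) D (s s' : smap G D) :
  (forall B x, s B x = s' B x) -> fsub P s = fsub P s'.
Proof.
  revert D s s'; induction P; intros D r r' H; cbn; f_equal; auto using sub_ext;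
  apply IHP; refine (vcaseP _ _ _); cbn; intros; unfold wk; rewrite ?H; auto.
Qed.

Lemma sub_var {G A} (t : tm G A) D (r : rmap G D) :
  sub t (fun B x => Var (r B x)) = ren t r.
Proof.
  revert D r; induction t; intros D r; cbn; f_equal; auto.
  rewrite <- IHt; apply sub_ext; refine (vcaseP _ _ _); reflexivity.
Qed.

Lemma ren_id {G A} (t : tm G A) : ren t (fun _ x => x) = t.
Proof.
  induction t; cbn; f_equal; auto.
  rewrite <- IHt at 2; apply ren_ext; refine (vcaseP _ _ _); reflexivity.
Qed.

Lemma sub_id {G A} (t : tm G A) : sub t (fun _ x => Var x) = t.
Proof. rewrite sub_var; apply ren_id. Qed.

Lemma ren_ren {G A} (t : tm G A) D E (r : rmap G D) (r' : rmap D E) :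
  ren (ren t r) r' = ren t (fun B x => r' B (r B x)).
Proof.
  revert D E r r'; induction t; intros; cbn; f_equal; auto.
  rewrite IHt; apply ren_ext; refine (vcaseP _ _ _); reflexivity.
Qed.

Lemma sub_ren {G A} (t : tm G A) D E (r : rmap G D) (s : smap D E) :
  sub (ren t r) s = sub t (fun B x => s B (r B x)).
Proof.
  revert D E r s; induction t; intros; cbn; f_equal; auto.
  rewrite IHt; apply sub_ext; refine (vcaseP _ _ _); reflexivity.
Qed.

Lemma ren_sub {G A} (t : tm G A) D E (s : smap G D) (r : rmap D E) :
  ren (sub t s) r = sub t (fun B x => ren (s B x) r).
Proof.
  revert D E r s; induction t; intros; cbn; f_equal; auto.
  rewrite IHt; apply sub_ext; refine (vcaseP _ _ _); [reflexivity|].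
  intros B' x; cbn; unfold wk; rewrite !ren_ren; reflexivity.
Qed.

Lemma sub_sub {G A} (t : tm G A) D E (s : smap G D) (s' : smap D E) :
  sub (sub t s) s' = sub t (fun B x => sub (s B x) s').
Proof.
  revert D E s s'; induction t; intros; cbn; f_equal; auto.
  rewrite IHt; apply sub_ext; refine (vcaseP _ _ _); [reflexivity|].
  intros B' x; cbn; unfold wk; rewrite sub_ren, ren_sub; reflexivity.
Qed.

Lemma fsub_fsub {G} (P : fm G) D E (s : smap G D) (s' : smap D E) :
  fsub (fsub P s) s' = fsub P (fun B x => sub (s B x) s').
Proof.
  revert D E s s'; induction P; intros; cbn; f_equal; auto using sub_sub;
  rewrite IHP; apply fsub_ext; refine (vcaseP _ _ _); try reflexivity;
  intros B' x; cbn; unfold wk; rewrite sub_ren, ren_sub; reflexivity.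
Qed.

Lemma fsub_id {G} (P : fm G) : fsub P (fun _ x => Var x) = P.
Proof.
  induction P; cbn; f_equal; auto using sub_id;
  rewrite <- IHP at 2; apply fsub_ext; refine (vcaseP _ _ _); reflexivity.
Qed.

Lemma ren_closed {A} (t : tm [] A) D E (r : rmap D E) : ren (closed t) r = closed t.
Proof. unfold closed; rewrite ren_ren; apply ren_ext; intros B x; exact (var_nil _ x). Qed.

Lemma sub_closed {A} (t : tm [] A) D E (s : smap D E) : sub (closed t) s = closed t.
Proof.
  unfold closed; rewrite sub_ren, <- sub_var.
  apply sub_ext; intros B x; exact (var_nil _ x).
Qed.

Lemma ren_can A G D (r : rmap G D) : ren (can A) r = can A.
Proof.
  revert G D r; induction A; intros; cbn; rewrite ?IHA1, ?IHA2, ?IHA; try reflexivity.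
Qed.

Lemma sub_can A G D (s : smap G D) : sub (can A) s = can A.
Proof.
  revert G D s; induction A; intros; cbn; rewrite ?ren_can, ?IHA1, ?IHA2, ?IHA; reflexivity.
Qed.

Ltac clo := intros; cbn; rewrite ?ren_can, ?sub_can; reflexivity.

(** These terms take the context only as a parameter, so substitution computes through them, except
    at [can], which recurses on the type. Their types are written with [Part] and [Strm] unfolded,
    the form in which the tactic [sb] meets them. *)
Section Closed.
Context (A B : ty) (G D : ctx) (r : rmap G D) (s : smap G D).
Lemma ren_iteT : ren (@iteT G A) r = iteT. Proof. clo. Qed.
Lemma sub_iteT : sub (@iteT G A) s = iteT. Proof. clo. Qed.
Lemma ren_predT : ren (@predT G) r = predT. Proof. clo. Qed.
Lemma sub_predT : sub (@predT G) s = predT. Proof. clo. Qed.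
Lemma ren_monusT : ren (@monusT G) r = monusT. Proof. clo. Qed.
Lemma sub_monusT : sub (@monusT G) s = monusT. Proof. clo. Qed.
Lemma ren_lenT : ren (@lenT G A) r = lenT. Proof. clo. Qed.
Lemma sub_lenT : sub (@lenT G A) s = lenT. Proof. clo. Qed.
Lemma ren_shatT : @ren G D (Seq A ~> TNat ~> A) shatT r = shatT. Proof. clo. Qed.
Lemma sub_shatT : @sub G D (Seq A ~> TNat ~> A) shatT s = shatT. Proof. clo. Qed.
Lemma ren_snocT : ren (@snocT G A) r = snocT. Proof. clo. Qed.
Lemma sub_snocT : sub (@snocT G A) s = snocT. Proof. clo. Qed.
Lemma ren_domT : @ren G D (Seq (Prod TNat A) ~> TNat ~> TNat) domT r = domT. Proof. clo. Qed.
Lemma sub_domT : @sub G D (Seq (Prod TNat A) ~> TNat ~> TNat) domT s = domT. Proof. clo. Qed.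
Lemma ren_phatT : @ren G D (Seq (Prod TNat A) ~> TNat ~> A) phatT r = phatT. Proof. clo. Qed.
Lemma sub_phatT : @sub G D (Seq (Prod TNat A) ~> TNat ~> A) phatT s = phatT. Proof. clo. Qed.
Lemma ren_updT : @ren G D (Seq (Prod TNat A) ~> TNat ~> A ~> Seq (Prod TNat A)) updT r = updT. Proof. clo. Qed.
Lemma sub_updT : @sub G D (Seq (Prod TNat A) ~> TNat ~> A ~> Seq (Prod TNat A)) updT s = updT. Proof. clo. Qed.
Lemma ren_segT : @ren G D (((TNat ~> A) ~> TNat) ~> (TNat ~> A) ~> TNat ~> Seq (Prod TNat A)) segT r = segT. Proof. clo. Qed.
Lemma sub_segT : @sub G D (((TNat ~> A) ~> TNat) ~> (TNat ~> A) ~> TNat ~> Seq (Prod TNat A)) segT s = segT. Proof. clo. Qed.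
Lemma sub_psegT : @sub G D (((TNat ~> A) ~> TNat) ~> Seq (Prod TNat A) ~> TNat ~> Seq (Prod TNat A)) psegT s = psegT. Proof. clo. Qed.
End Closed.

Lemma sub_wk {G D A B} (t : tm G A) (s : smap G D) :
  sub (wk B t) (slift B s) = wk B (sub t s).
Proof. unfold wk; rewrite sub_ren, ren_sub; reflexivity. Qed.

Lemma sub_inst {G D A B} (b : tm (A :: G) B) a (s : smap G D) :
  sub (inst b a) s = inst (sub b (slift A s)) (sub a s).
Proof.
  unfold inst; rewrite !sub_sub; apply sub_ext; refine (vcaseP _ _ _); [reflexivity|].
  intros; cbn; unfold wk. rewrite sub_ren; cbn. symmetry; apply sub_id.
Qed.

(** The premise says that renaming the parameters commutes with the two substitutions. It is applied
    with shifts past one, two or three binders, as they occur in the induction schemas and in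
    [sBI_fm]. *)
Lemma fsub_fat {G G' D D' A} (P : fm (A :: G)) (r : rmap G D) a
  (s : smap G G') (s' : smap D D') (r' : rmap G' D') :
  (forall B x, s' B (r B x) = ren (s B x) r') ->
  fsub (fat P r a) s' = fat (fsub P (slift A s)) r' (sub a s').
Proof.
  intros H; unfold fat; rewrite !fsub_fsub; apply fsub_ext; refine (vcaseP _ _ _); [reflexivity|].
  intros; cbn; unfold wk; rewrite sub_ren; cbn. rewrite H; symmetry; apply sub_var.
Qed.

Lemma fsub_finst {G D A} (P : fm (A :: G)) a (s : smap G D) :
  fsub (finst P a) s = finst (fsub P (slift A s)) (sub a s).
Proof. apply fsub_fat; intros; symmetry; apply ren_id. Qed.

Lemma fsub_fwk {G D B} (P : fm G) (s : smap G D) :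
  fsub (fwk B P) (slift B s) = fwk B (fsub P s).
Proof. unfold fwk; rewrite !fsub_fsub; apply fsub_ext; intros; cbn; symmetry; apply sub_var. Qed.

Lemma fsub_map_fwk {G D B} (Hs : list (fm G)) (s : smap G D) :
  map (fun P => fsub P (slift B s)) (map (fwk B) Hs) = map (fwk B) (map (fun P => fsub P s) Hs).
Proof. rewrite !map_map; apply map_ext; intros; apply fsub_fwk. Qed.

(** Each schema is stated for all contexts, terms and formulas, so an instance goes to an instance.
    Only the two induction schemas need work, because they move the parameters of the formula under
    new binders. *)
Lemma EHA_fsub G D (P : fm G) (s : smap G D) : EHA P -> EHA (fsub P s).
Proof.
  intros H; revert D s; destruct H as [G' A t|G' A P' t u|G' A B b a|G' A B f g|G' A B a b|G' A B a b|G' A B p|G' n|G' m n|G' P'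
    |G' A a f|G' A a f n|G' A P'|G' A B b f|G' A B b f x u]; intros D s; unfold Neg; cbn [fsub sub];
  rewrite ?fsub_finst, ?sub_wk, ?sub_inst; try (constructor; fail).
  - cbn. erewrite fsub_fat with (s := s) (r' := fun B x => VS x); [apply ax_ind|].
    intros; reflexivity.
  - cbn. do 2 (erewrite fsub_fat with (s := s) (r' := fun _ x => VS (VS x));
     [|intros; cbn; unfold wk; rewrite ren_ren; reflexivity]).
    apply ax_sind.
Qed.

Lemma EHA_sBI_BR_fsub G D (P : fm G) (s : smap G D) : EHA_sBI_BR P -> EHA_sBI_BR (fsub P s).
Proof.
  intros H; revert D s; destruct H as [G' P' [G'' P'' H|G'' P'' H]|G' P' H]; [|destruct H..];
  intros D s; [left; left; apply EHA_fsub; assumption| |].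
  - left; right. unfold sBI_fm. cbn [fsub].
    do 2 (erewrite fsub_fat with (s := s) (r' := fun _ x => VS (VS (VS x)));
     [|intros; cbn; unfold wk; rewrite !ren_ren; reflexivity]).
    erewrite fsub_fat with (s := s) (r' := fun _ x => (VS (VS x)));
     [|intros; cbn; unfold wk; rewrite !ren_ren; reflexivity].
    erewrite fsub_fat with (s := s) (r' := fun _ x => ((VS x)));
     [|intros; cbn; unfold wk; rewrite ?ren_ren; reflexivity].
    unfold seg, Sgood, InDom, Neg, pseg, len, upd, phat, domc, Part, Strm. cbn [fsub sub].
    rewrite sub_segT, !sub_psegT, sub_lenT, !sub_domT, !sub_phatT, !sub_updT.
    apply sBI_intro.
  - right. unfold BR_eqn, EqCases, Lt, Neg, monus, shat, len, snoc, Strm. cbn [fsub sub].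
    rewrite !sub_monusT, !sub_shatT, !sub_lenT, !sub_snocT.
    apply BR_intro.
Qed.

(** * Weakening and substitution of derivations *)

Notation T := EHA_sBI_BR.

Lemma prv_incl G (Hs Ks : list (fm G)) P : incl Hs Ks -> prv T Hs P -> prv T Ks P.
Proof.
  intros I H; revert Ks I; induction H; intros Ks I.
  - apply p_ax; assumption.
  - apply p_hyp; auto.
  - apply p_botE; auto.
  - apply p_andI; auto.
  - eapply p_andL; eauto.
  - eapply p_andR; eauto.
  - apply p_orL; auto.
  - apply p_orR; auto.
  - eapply p_orE; eauto; [apply IHprv2|apply IHprv3]; apply incl_cons; auto with datatypes.
  - apply p_impI, IHprv, incl_cons; auto with datatypes.
  - eapply p_impE; eauto.
  - apply p_allI, IHprv, incl_map, I.
  - apply p_allE; auto.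
  - eapply p_exI; eauto.
  - eapply p_exE; eauto. apply IHprv2, incl_cons; auto using incl_map with datatypes.
Qed.

(** Whole derivations can be substituted since the axioms are closed under substitution. This is
    what carries hypotheses into the extended contexts of the rules below. *)
Lemma prv_fsub G (Hs : list (fm G)) P : prv T Hs P ->
  forall D (s : smap G D), prv T (map (fun Q => fsub Q s) Hs) (fsub P s).
Proof.
  induction 1; intros D s; cbn [fsub] in *.
  - apply p_ax, EHA_sBI_BR_fsub; assumption.
  - apply p_hyp, (in_map (fun Q => fsub Q s)); assumption.
  - apply p_botE; auto.
  - apply p_andI; auto.
  - eapply p_andL; eauto.
  - eapply p_andR; eauto.
  - apply p_orL; auto.
  - apply p_orR; auto.
  - eapply p_orE; eauto; [apply IHprv2|apply IHprv3]; apply incl_cons; auto with datatypes.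
  - apply p_impI, IHprv.
  - eapply p_impE; eauto.
  - apply p_allI. rewrite <- fsub_map_fwk. apply IHprv.
  - rewrite fsub_finst. apply p_allE; auto.
  - apply p_exI with (sub a s). rewrite <- fsub_finst. auto.
  - eapply p_exE; eauto. rewrite <- fsub_map_fwk, <- fsub_fwk. apply IHprv2.
Qed.

(** * Derived rules *)

Definition eqv {G} (Hs : list (fm G)) {A} (t u : tm G A) : Prop := prv T Hs (Eq t u).

Definition finer {G D} (Hs : list (fm G)) (Ks : list (fm D)) (s : smap G D) : Prop :=
  forall P, prv T Hs P -> prv T Ks (fsub P s).

Lemma finer_cons {G} (Hs : list (fm G)) P Q : prv T Hs Q -> prv T (P :: Hs) Q.
Proof. apply prv_incl, incl_tl, incl_refl. Qed.

Lemma finer_wk {G} (Hs : list (fm G)) A : finer Hs (map (fwk A) Hs) (fun _ x => Var (VS x)).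
Proof. intros P H; apply (prv_fsub _ _ _ H). Qed.

Lemma fsub_scons_wk {G A} (P : fm (A :: G)) : fsub P (scons v0 (fun _ x => Var (VS x))) = P.
Proof.
  rewrite <- fsub_id; apply fsub_ext; refine (vcaseP _ _ _); reflexivity.
Qed.

Lemma hyp0 {G} (Hs : list (fm G)) P : prv T (P :: Hs) P.
Proof. apply p_hyp; left; reflexivity. Qed.

(* The rules below have the shape of a Kripke forcing semantics: premises range
   over all contexts and hypotheses [Ks] to which those at hand transfer along a
   substitution.  Eigenvariables are thus arbitrary terms named in Rocq, and no de
   Bruijn index survives outside the quantified formula itself. *)
Section Rules.
Context {G : ctx} (Hs : list (fm G)).

Lemma impI P Q :
  (forall Ks, (forall C, prv T Hs C -> prv T Ks C) -> prv T Ks P -> prv T Ks Q) ->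
  prv T Hs (Imp P Q).
Proof. intros H; apply p_impI, H; [intros; apply finer_cons; assumption|apply hyp0]. Qed.

Lemma orE P Q C : prv T Hs (Or P Q) ->
  (forall Ks, (forall C, prv T Hs C -> prv T Ks C) -> prv T Ks P -> prv T Ks C) ->
  (forall Ks, (forall C, prv T Hs C -> prv T Ks C) -> prv T Ks Q -> prv T Ks C) ->
  prv T Hs C.
Proof.
  intros H H1 H2; apply (p_orE H); [apply H1|apply H2];
  first [apply hyp0|intros; apply finer_cons; assumption].
Qed.

Lemma allI A (P : fm (A :: G)) :
  (forall D (Ks : list (fm D)) (a : tm D A) s, finer Hs Ks s -> prv T Ks (fsub P (scons a s))) ->
  prv T Hs (All A P).
Proof.
  intros H; apply p_allI. rewrite <- fsub_scons_wk. apply H, finer_wk.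
Qed.

Lemma allE A (P : fm (A :: G)) : prv T Hs (All A P) ->
  forall a, prv T Hs (fsub P (scons a (fun _ x => Var x))).
Proof. intros H a; exact (p_allE a H). Qed.

Lemma exI A (P : fm (A :: G)) a :
  prv T Hs (fsub P (scons a (fun _ x => Var x))) -> prv T Hs (Ex A P).
Proof. exact (@p_exI _ _ _ _ P a). Qed.

Lemma exE A (P : fm (A :: G)) C : prv T Hs (Ex A P) ->
  (forall D (Ks : list (fm D)) (a : tm D A) s, finer Hs Ks s ->
    prv T Ks (fsub P (scons a s)) -> prv T Ks (fsub C s)) ->
  prv T Hs C.
Proof.
  intros H H1; eapply p_exE; [exact H|]. apply H1 with (a := v0).
  - intros Q HQ; apply finer_cons, finer_wk, HQ.
  - rewrite fsub_scons_wk; apply hyp0.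
Qed.

Lemma nat_ind (P : fm (TNat :: G)) :
  prv T Hs (fsub P (scons (Con Zero) (fun _ x => Var x))) ->
  (forall D (Ks : list (fm D)) n s, finer Hs Ks s ->
    prv T Ks (fsub P (scons n s)) -> prv T Ks (fsub P (scons (Con Succ $ n) s))) ->
  prv T Hs (All TNat P).
Proof.
  intros H0 H1. eapply p_impE; [eapply p_impE|];
    [apply p_ax; left; left; apply ax_ind|exact H0|].
  apply p_allI, p_impI. apply H1.
  - intros Q HQ; apply finer_cons, finer_wk, HQ.
  - rewrite fsub_scons_wk; apply hyp0.
Qed.

Lemma seq_ind A (P : fm (Seq A :: G)) :
  prv T Hs (fsub P (scons (Con Nil) (fun _ x => Var x))) ->
  (forall D (Ks : list (fm D)) x u s, finer Hs Ks s ->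
    prv T Ks (fsub P (scons u s)) -> prv T Ks (fsub P (scons (Con Cons $ x $ u) s))) ->
  prv T Hs (All (Seq A) P).
Proof.
  intros H0 H1. eapply p_impE; [eapply p_impE|];
    [apply p_ax; left; left; apply ax_sind|exact H0|].
  apply p_allI, p_allI, p_impI. apply H1 with (s := fun _ x => Var (VS (VS x))).
  - intros Q HQ; apply finer_cons.
    replace (fsub Q _) with (fwk (Seq A) (fwk A Q)) by (unfold fwk; rewrite fsub_fsub; reflexivity).
    apply finer_wk, finer_wk, HQ.
  - apply hyp0.
Qed.

Lemma eqv_refl A (t : tm G A) : eqv Hs t t.
Proof. apply p_ax; left; left; apply ax_refl. Qed.

Lemma leib A (P : fm (A :: G)) t u : eqv Hs t u ->
  prv T Hs (fsub P (scons t (fun _ x => Var x))) ->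
  prv T Hs (fsub P (scons u (fun _ x => Var x))).
Proof.
  intros H H1. eapply p_impE; [eapply p_impE|]; [|exact H|exact H1].
  apply p_ax; left; left; apply (ax_leib P).
Qed.

Lemma eqv_sym A (t u : tm G A) : eqv Hs t u -> eqv Hs u t.
Proof.
  intros H. pose proof (leib _ (Eq v0 (wk A t)) t u H) as L. cbn in L.
  unfold wk in L; rewrite !sub_ren in L; cbn in L; rewrite !sub_id in L. apply L, eqv_refl.
Qed.

Lemma eqv_trans A (t u v : tm G A) : eqv Hs t u -> eqv Hs u v -> eqv Hs t v.
Proof.
  intros H H'. pose proof (leib _ (Eq (wk A t) v0) u v H') as L. cbn in L.
  unfold wk in L; rewrite !sub_ren in L; cbn in L; rewrite !sub_id in L. apply L, H.
Qed.

Lemma eqv_app A B (f g : tm G (A ~> B)) t u : eqv Hs f g -> eqv Hs t u -> eqv Hs (f $ t) (g $ u).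
Proof.
  intros H H'. apply eqv_trans with (f $ u).
  - pose proof (leib _ (Eq (wk A (f $ t)) (wk A f $ v0)) t u H') as L. cbn in L.
    unfold wk in L; rewrite !sub_ren in L; cbn in L; rewrite !sub_id in L. apply L, eqv_refl.
  - pose proof (leib _ (Eq (wk _ (f $ u)) (v0 $ wk _ u)) f g H) as L. cbn in L.
    unfold wk in L; rewrite !sub_ren in L; cbn in L; rewrite !sub_id in L. apply L, eqv_refl.
Qed.

Lemma beta A B (b : tm (A :: G) B) a : eqv Hs (Lam b $ a) (sub b (scons a (fun _ x => Var x))).
Proof. apply p_ax; left; left; apply ax_beta. Qed.

Lemma ext A B (f g : tm G (A ~> B)) :
  (forall D (Ks : list (fm D)) a s, finer Hs Ks s -> eqv Ks (sub f s $ a) (sub g s $ a)) ->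
  eqv Hs f g.
Proof.
  intros H. eapply p_impE; [apply p_ax; left; left; apply ax_ext|].
  apply p_allI. pose proof (H _ (map (fwk A) Hs) v0 _ (finer_wk Hs A)) as L.
  rewrite !sub_var in L; exact L.
Qed.

End Rules.
Arguments orE {G Hs P Q C}.
Arguments exE {G Hs A P C}.
Arguments allE {G Hs A P}.

#[global] Instance eqv_equiv G Hs A : Equivalence (@eqv G Hs A).
Proof. split; red; [apply eqv_refl|apply eqv_sym|apply eqv_trans]. Qed.

#[global] Instance App_proper G Hs A B :
  Proper (@eqv G Hs (A ~> B) ==> @eqv G Hs A ==> @eqv G Hs B) (@App G A B).
Proof. repeat intro; apply eqv_app; assumption. Qed.

Section Constants.
Context {G : ctx} (Hs : list (fm G)).
Lemma rec_0 A (a : tm G A) f : eqv Hs (Con Rec $ a $ f $ Con Zero) a.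
Proof. apply p_ax; left; left; constructor. Qed.
Lemma rec_S A (a : tm G A) f n :
  eqv Hs (Con Rec $ a $ f $ (Con Succ $ n)) (f $ n $ (Con Rec $ a $ f $ n)).
Proof. apply p_ax; left; left; constructor. Qed.
Lemma srec_nil A B (b : tm G B) (f : tm G (A ~> Seq A ~> B ~> B)) :
  eqv Hs (Con SRec $ b $ f $ Con Nil) b.
Proof. apply p_ax; left; left; constructor. Qed.
Lemma srec_cons A B (b : tm G B) (f : tm G (A ~> Seq A ~> B ~> B)) x s :
  eqv Hs (Con SRec $ b $ f $ (Con Cons $ x $ s)) (f $ x $ s $ (Con SRec $ b $ f $ s)).
Proof. apply p_ax; left; left; constructor. Qed.
Lemma fst_pair A B (a : tm G A) (b : tm G B) : eqv Hs (Con Fst $ (Con Pair $ a $ b)) a.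
Proof. apply p_ax; left; left; constructor. Qed.
Lemma snd_pair A B (a : tm G A) (b : tm G B) : eqv Hs (Con Snd $ (Con Pair $ a $ b)) b.
Proof. apply p_ax; left; left; constructor. Qed.
Lemma S_inj (m n : tm G TNat) : eqv Hs (Con Succ $ m) (Con Succ $ n) -> eqv Hs m n.
Proof. apply p_impE, p_ax; left; left; constructor. Qed.
Lemma S_neq_0 (m : tm G TNat) P : eqv Hs (Con Succ $ m) (Con Zero) -> prv T Hs P.
Proof. intros H; apply p_botE; revert H; apply p_impE, p_ax; left; left; constructor. Qed.
End Constants.
Arguments S_neq_0 {G Hs m P}.
Arguments S_inj {G Hs m n}.

(** * Normalisation of substitutions, and tactics with named eigenvariables *)

Lemma sub_ren_r {G A} (t : tm G A) D E (s : smap G D) (r : rmap D E) :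
  sub t (fun B x => ren (s B x) r) = ren (sub t s) r.
Proof. symmetry; apply ren_sub. Qed.
(** Hooks for formulas that are later kept folded: each such formula comes with a lemma that pushes
    substitutions through it, and the hooks are redefined to use it. *)
Ltac sb_ext := fail.
Ltac sb_ext_in H := fail.
Ltac sb :=
  match goal with
  | |- context [sub iteT ?s] => rewrite sub_iteT
  | |- context [ren iteT ?s] => rewrite ren_iteT
  | |- context [sub predT ?s] => rewrite sub_predT
  | |- context [ren predT ?s] => rewrite ren_predT
  | |- context [sub monusT ?s] => rewrite sub_monusT
  | |- context [ren monusT ?s] => rewrite ren_monusT
  | |- context [sub lenT ?s] => rewrite sub_lenT
  | |- context [ren lenT ?s] => rewrite ren_lenT
  | |- context [@sub _ _ _ shatT _] => rewrite sub_shatT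
  | |- context [@ren _ _ _ shatT _] => rewrite ren_shatT
  | |- context [sub snocT ?s] => rewrite sub_snocT
  | |- context [ren snocT ?s] => rewrite ren_snocT
  | |- context [@sub _ _ _ domT _] => rewrite sub_domT
  | |- context [@ren _ _ _ domT _] => rewrite ren_domT
  | |- context [@sub _ _ _ phatT _] => rewrite sub_phatT
  | |- context [@ren _ _ _ phatT _] => rewrite ren_phatT
  | |- context [@sub _ _ _ updT _] => rewrite sub_updT
  | |- context [@ren _ _ _ updT _] => rewrite ren_updT
  | |- context [@sub _ _ _ segT _] => rewrite sub_segT
  | |- context [@ren _ _ _ segT _] => rewrite ren_segT
  | |- context [@sub _ _ _ psegT _] => rewrite sub_psegT
  | |- context [sub (can _) ?s] => rewrite sub_can
  | |- context [ren (can _) ?s] => rewrite ren_can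
  | |- context [sub (closed _) ?s] => rewrite sub_closed
  | |- context [ren (closed _) ?s] => rewrite ren_closed
  | |- context [ren (ren _ _) _] => rewrite ren_ren
  | |- context [sub (ren _ _) _] => rewrite sub_ren
  | |- context [ren ?t (fun A x => x)] => rewrite ren_id
  | |- context [sub ?t (fun A x => Var (@?r A x))] => rewrite sub_var
  | |- context [sub ?t (fun A x => ren (@?f A x) _)] => rewrite sub_ren_r
  | |- context [@sub ?G ?G _ ?t _] => rewrite (@sub_id G)
  | _ => sb_ext
  end.
Ltac sb_in H :=
  match type of H with
  | context [sub iteT ?s] => rewrite sub_iteT in H
  | context [ren iteT ?s] => rewrite ren_iteT in H
  | context [sub predT ?s] => rewrite sub_predT in H
  | context [ren predT ?s] => rewrite ren_predT in H
  | context [sub monusT ?s] => rewrite sub_monusT in H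
  | context [ren monusT ?s] => rewrite ren_monusT in H
  | context [sub lenT ?s] => rewrite sub_lenT in H
  | context [ren lenT ?s] => rewrite ren_lenT in H
  | context [@sub _ _ _ shatT _] => rewrite sub_shatT in H
  | context [@ren _ _ _ shatT _] => rewrite ren_shatT in H
  | context [sub snocT ?s] => rewrite sub_snocT in H
  | context [ren snocT ?s] => rewrite ren_snocT in H
  | context [@sub _ _ _ domT _] => rewrite sub_domT in H
  | context [@ren _ _ _ domT _] => rewrite ren_domT in H
  | context [@sub _ _ _ phatT _] => rewrite sub_phatT in H
  | context [@ren _ _ _ phatT _] => rewrite ren_phatT in H
  | context [@sub _ _ _ updT _] => rewrite sub_updT in H
  | context [@ren _ _ _ updT _] => rewrite ren_updT in H
  | context [@sub _ _ _ segT _] => rewrite sub_segT in H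
  | context [@ren _ _ _ segT _] => rewrite ren_segT in H
  | context [@sub _ _ _ psegT _] => rewrite sub_psegT in H
  | context [sub (can _) ?s] => rewrite sub_can in H
  | context [ren (can _) ?s] => rewrite ren_can in H
  | context [sub (closed _) ?s] => rewrite sub_closed in H
  | context [ren (closed _) ?s] => rewrite ren_closed in H
  | context [ren (ren _ _) _] => rewrite ren_ren in H
  | context [sub (ren _ _) _] => rewrite sub_ren in H
  | context [ren ?t (fun A x => x)] => rewrite ren_id in H
  | context [sub ?t (fun A x => Var (@?r A x))] => rewrite sub_var in H
  | context [sub ?t (fun A x => ren (@?f A x) _)] => rewrite sub_ren_r in H
  | context [@sub ?G ?G _ ?t _] => rewrite (@sub_id G) in H
  | _ => sb_ext_in H
  end.
Ltac unf := unfold finst, fat, fwk, Sgood, pseg, inst, wk, Neg, domc, phat, upd, cmp, ite, monus, len, shat, snoc, seg, EqCases, Lt, InDom, BarRecTy, Part, Strm.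
Ltac unf_in H := unfold finst, fat, fwk, Sgood, pseg, inst, wk, Neg, domc, phat, upd, cmp, ite, monus, len, shat, snoc, seg, EqCases, Lt, InDom, BarRecTy, Part, Strm in H.
Ltac eqv_fold := match goal with
  | |- prv _ ?K (Eq ?t ?u) => change (eqv K t u) | _ => idtac end.
Ltac eqv_fold_in H := match type of H with
  | prv _ ?K (Eq ?t ?u) => change (eqv K t u) in H | _ => idtac end.
Ltac simp := unf;
  cbn [sub ren fsub scons slift vcase rlift]; unfold wk;
  repeat (sb; cbn [sub ren fsub scons slift vcase rlift]; unfold wk);
  eqv_fold.
Ltac simp_in H := unf_in H;
  cbn [sub ren fsub scons slift vcase rlift] in H; unfold wk in H;
  repeat (sb_in H; cbn [sub ren fsub scons slift vcase rlift] in H; unfold wk in H);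
  eqv_fold_in H.

Ltac bt := simp; repeat (rewrite beta; simp).

(* Transfers all hypotheses along [W] and then forgets that the terms in them are
   substitution instances. *)
Ltac push W := match type of W with
  | finer ?Hs ?Ks ?s =>
    repeat match goal with
    | H : prv _ Hs _ |- _ => apply W in H; simp_in H
    | H : eqv Hs _ _ |- _ => apply W in H; simp_in H
    end; simp;
    match type of s with smap ?G ?D =>
      repeat match goal with u : tm G _ |- _ =>
        let u' := fresh u in set (u' := sub u s) in *; clearbody u'; clear u; rename u' into u
      end;
      clear W; try (clear s); try clear Hs; try clear G; try rename D into G; try rename Ks into Hs
    end
  | forall C, prv _ ?Hs C -> prv _ ?Ks C =>
    repeat match goal with
    | H : prv _ Hs _ |- _ => apply W in H
    | H : eqv Hs _ _ |- _ => apply W in H; eqv_fold_in H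
    end; clear W; try clear Hs; try rename Ks into Hs
  end.

Tactic Notation "all_intro" ident(x) := simp; apply allI; intros ?D ?Ks x ?s ?W; push W.
Tactic Notation "imp_intro" ident(H) := simp; apply impI; intros ?Ks ?W H; push W; eqv_fold_in H; eqv_fold.
Tactic Notation "or_elim" constr(H) "as" ident(H1) :=
  simp; refine (orE H _ _); try clear H; intros ?Ks ?W H1; push W; eqv_fold_in H1; eqv_fold.
Tactic Notation "ex_elim" constr(H) "as" ident(x) ident(H1) :=
  simp; refine (exE H _); try clear H; intros ?D ?Ks x ?s ?W H1; simp_in H1; push W.
Tactic Notation "nat_elim" ident(n) ident(IH) :=
  simp; apply nat_ind; [|intros ?D ?Ks n ?s ?W IH; simp_in IH; push W]; [simp|].
Tactic Notation "seq_elim" ident(x) ident(s) ident(IH) :=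
  simp; apply seq_ind; [|intros ?D ?Ks x s ?s ?W IH; simp_in IH; push W]; [simp|].
Tactic Notation "spec" hyp(H) constr(arg) "as" ident(K) :=
  pose proof (allE H arg) as K; simp_in K.
Tactic Notation "spec" hyp(H) constr(arg) :=
  let K := fresh in spec H arg as K; clear H; rename K into H.
Notation "'S'' n" := (Con Succ $ n) (at level 24, right associativity).
Notation O' := (Con Zero).

Ltac or_l := apply p_orL; eqv_fold.
Ltac or_r := apply p_orR; eqv_fold.
Ltac and_i := apply p_andI; eqv_fold.
Ltac ex t := apply exI with t; simp.
Tactic Notation "unfold_closed" constr(c) reference(h) :=
  repeat match goal with |- context [@closed ?G ?A c] => change (@closed G A c) with (@ren nil G A c novar) end;
  unfold h.

(** * Arithmetic *)

Section Ite.
Context {G : ctx} (Hs : list (fm G)).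
Lemma ite_0 A (t e : tm G A) : eqv Hs (iteT $ O' $ t $ e) e.
Proof. unfold iteT. bt. apply rec_0. Qed.
Lemma ite_S A c (t e : tm G A) : eqv Hs (iteT $ (S' c) $ t $ e) t.
Proof. unfold iteT. bt. rewrite rec_S. bt. reflexivity. Qed.
Lemma pred_0 : eqv Hs (predT $ O') O'.
Proof. unfold predT. apply rec_0. Qed.
Lemma pred_S n : eqv Hs (predT $ (S' n)) n.
Proof. unfold predT. rewrite rec_S; bt; reflexivity. Qed.
Lemma monus_0 m : eqv Hs (monusT $ m $ O') m.
Proof. unfold monusT. bt. apply rec_0. Qed.
Lemma monus_S m n : eqv Hs (monusT $ m $ (S' n)) (predT $ (monusT $ m $ n)).
Proof. unfold monusT. bt. rewrite rec_S. bt. reflexivity. Qed.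
End Ite.

Definition addT0 : tm [] (TNat ~> TNat ~> TNat) :=
  Lam (Lam (Con Rec $ v1 $ Lam (Lam (S' v0)) $ v0)).
Notation addT := (closed addT0).
Notation "m ⊹ n" := (addT $ m $ n) (at level 26, left associativity).

Section Arith.
Context {G : ctx} (Hs : list (fm G)).
Lemma add_0 m : eqv Hs (m ⊹ O') m.
Proof. unfold closed, addT0. bt. apply rec_0. Qed.
Lemma add_S m n : eqv Hs (m ⊹ (S' n)) (S' (m ⊹ n)).
Proof. unfold closed, addT0. bt. rewrite rec_S. bt. reflexivity. Qed.
End Arith.

Section MoreArith.
Context {G : ctx} (Hs : list (fm G)).

Lemma monus_SS m n : eqv Hs (monusT $ (S' m) $ (S' n)) (monusT $ m $ n).
Proof.
  (* Induction acts on an object formula, so the fixed terms are weakened under its binder; [spec]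
     cancels the weakening on instantiation. The same pattern recurs throughout. *)
  assert (H : prv T Hs (All TNat (Eq (monusT $ (S' (wk _ m)) $ (S' v0)) (monusT $ wk _ m $ v0)))).
  - nat_elim k IH.
    + rewrite monus_S, !monus_0. apply pred_S.
    + rewrite monus_S, IH, <- monus_S. reflexivity.
  - spec H n. exact H.
Qed.

Lemma zero_monus n : eqv Hs (monusT $ O' $ n) O'.
Proof.
  assert (H : prv T Hs (All TNat (Eq (monusT $ O' $ v0) O'))).
  - nat_elim k IH; [apply monus_0|]. rewrite monus_S, IH. apply pred_0.
  - spec H n. exact H.
Qed.

Lemma zero_add n : eqv Hs (O' ⊹ n) n.
Proof.
  assert (H : prv T Hs (All TNat (Eq (O' ⊹ v0) v0))).
  - nat_elim k IH; [apply add_0|]. rewrite add_S, IH. reflexivity.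
  - spec H n. exact H.
Qed.

Lemma S_add m n : eqv Hs ((S' m) ⊹ n) (S' (m ⊹ n)).
Proof.
  assert (H : prv T Hs (All TNat (Eq ((S' wk _ m) ⊹ v0) (S' (wk _ m ⊹ v0))))).
  - nat_elim k IH; [rewrite !add_0; reflexivity|]. rewrite !add_S, IH. reflexivity.
  - spec H n. exact H.
Qed.

End MoreArith.

Lemma add_comm G (Hs : list (fm G)) m n : eqv Hs (m ⊹ n) (n ⊹ m).
Proof.
  assert (H : prv T Hs (All TNat (Eq (wk _ m ⊹ v0) (v0 ⊹ wk _ m)))).
  - nat_elim k IH; [rewrite add_0, zero_add; reflexivity|]. rewrite add_S, S_add, IH. reflexivity.
  - spec H n. exact H.
Qed.

Lemma add_assoc G (Hs : list (fm G)) m n k : eqv Hs (m ⊹ (n ⊹ k)) (m ⊹ n ⊹ k).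
Proof.
  assert (H : prv T Hs (All TNat (Eq (wk _ m ⊹ (wk _ n ⊹ v0)) (wk _ m ⊹ wk _ n ⊹ v0)))).
  - nat_elim l IH; [rewrite !add_0; reflexivity|]. rewrite !add_S, IH. reflexivity.
  - spec H k. exact H.
Qed.

Lemma nat_case G (Hs : list (fm G)) n : prv T Hs (Or (Eq n O') (Ex TNat (Eq (wk _ n) (S' v0)))).
Proof.
  assert (H : prv T Hs (All TNat (Or (Eq v0 O') (Ex TNat (Eq v1 (S' v0)))))).
  - nat_elim k IH; [or_l; apply eqv_refl|]. or_r; ex k. reflexivity.
  - spec H n. exact H.
Qed.

Lemma monus_add_add G (Hs : list (fm G)) k m n :
  eqv Hs (monusT $ (k ⊹ m) $ (k ⊹ n)) (monusT $ m $ n).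
Proof.
  assert (H : prv T Hs (All TNat (Eq (monusT $ (v0 ⊹ wk _ m) $ (v0 ⊹ wk _ n)) (monusT $ wk _ m $ wk _ n)))).
  - nat_elim l IH; [rewrite !zero_add; reflexivity|]. rewrite !S_add, monus_SS, IH. reflexivity.
  - spec H k. exact H.
Qed.

Lemma monus_add_l G (Hs : list (fm G)) k m : eqv Hs (monusT $ (k ⊹ m) $ k) m.
Proof. rewrite <- (add_0 _ k) at 2. rewrite monus_add_add. apply monus_0. Qed.

Lemma monus_add_r G (Hs : list (fm G)) k m : eqv Hs (monusT $ k $ (k ⊹ m)) O'.
Proof. rewrite <- (add_0 _ k) at 1. rewrite monus_add_add. apply zero_monus. Qed.

Lemma monus_self G (Hs : list (fm G)) k : eqv Hs (monusT $ k $ k) O'.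
Proof. rewrite <- (add_0 _ k) at 2. apply monus_add_r. Qed.

(** The strict cases carry the gap as a witness. Rewriting with such an equation lets truncated
    subtraction, and with it every comparison in the codes, compute. *)
Lemma tri G (Hs : list (fm G)) m n :
  prv T Hs (Or (Ex TNat (Eq (wk _ n) (wk _ m ⊹ (S' v0))))
           (Or (Eq m n) (Ex TNat (Eq (wk _ m) (wk _ n ⊹ (S' v0)))))).
Proof.
  assert (H : prv T Hs (All TNat (All TNat (Or (Ex TNat (Eq v1 (v2 ⊹ (S' v0))))
           (Or (Eq v1 v0) (Ex TNat (Eq v2 (v1 ⊹ (S' v0))))))))).
  - nat_elim k IH.
    + all_intro l. pose proof (nat_case _ Hs l) as C.
      or_elim C as E; [or_r; or_l; rewrite E; reflexivity|].
      or_l. ex_elim E as d E. ex d. rewrite zero_add. exact E.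
    + all_intro l. pose proof (nat_case _ Hs l) as C. or_elim C as E.
      * or_r; or_r; ex k. rewrite E, zero_add. reflexivity.
      * ex_elim E as d E. spec IH d. or_elim IH as IH1; [or_l|or_r; or_elim IH1 as IH2;
          [or_l|or_r]].
        -- ex_elim IH1 as e IH1. ex e. rewrite E, S_add, IH1. reflexivity.
        -- rewrite E, IH2. reflexivity.
        -- ex_elim IH2 as e IH2. ex e. rewrite E, S_add, IH2. reflexivity.
  - spec H m. spec H n. exact H.
Qed.

Notation CMP n k a b c := (iteT $ (monusT $ k $ n) $ a $ (iteT $ (monusT $ n $ k) $ c $ b)).

Section Cmp.
Context {G : ctx} (Hs : list (fm G)) (A : ty) (n k d : tm G TNat) (a b c : tm G A).
Notation cmp' := (CMP n k a b c).
Lemma cmp_lt : eqv Hs k (n ⊹ (S' d)) -> eqv Hs cmp' a.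
Proof. intros H. simp. rewrite H, monus_add_l. apply ite_S. Qed.
Lemma cmp_eq : eqv Hs n k -> eqv Hs cmp' b.
Proof. intros H. simp. rewrite H, monus_self, !ite_0. reflexivity. Qed.
Lemma cmp_gt : eqv Hs n (k ⊹ (S' d)) -> eqv Hs cmp' c.
Proof. intros H. simp. rewrite H, monus_add_l, monus_add_r, ite_0, ite_S. reflexivity. Qed.
Lemma gap : eqv Hs n (k ⊹ (S' d)) -> eqv Hs (predT $ (monusT $ n $ k)) d.
Proof. intros H. rewrite H, monus_add_l. apply pred_S. Qed.
End Cmp.
Arguments cmp_lt {G Hs A n k d a b c}.
Arguments cmp_eq {G Hs A n k a b c}.
Arguments cmp_gt {G Hs A n k d a b c}.
Arguments gap {G Hs n k d}.

(** * Finite partial functions *)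

Notation One := (S' O').
Notation CONS x s := (Con Cons $ x $ s).
Notation PAIR x s := (Con Pair $ x $ s).
Notation FST p := (Con Fst $ p).
Notation SND p := (Con Snd $ p).
(* [Part] and [Strm] must not occur folded in the implicit type arguments of
   [App], since the setoid rewriting compares these syntactically. *)
Notation PT X := (Seq (Prod TNat X)).
Notation DOM u n := (@App _ TNat TNat (@App _ (PT _) (TNat ~> TNat) domT u) n).
Notation PHAT u := (@App _ (PT _) (TNat ~> _) phatT u).
Notation HAT u n := (PHAT u $ n).
Notation UPD u n x := (@App _ _ (PT _) (@App _ TNat (_ ~> PT _)
  (@App _ (PT _) (TNat ~> _ ~> PT _) updT u) n) x).
Notation SHAT s := (@App _ (Seq _) (TNat ~> _) shatT s).
Notation PM m n := (predT $ (monusT $ m $ n)).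

Lemma unfold_nil G (Hs : list (fm G)) A B (c : tm G (Seq A ~> B)) b f :
  c = Con SRec $ b $ f -> eqv Hs (c $ Con Nil) b.
Proof. intros ->; apply srec_nil. Qed.

Lemma unfold_cons G (Hs : list (fm G)) A B (c : tm G (Seq A ~> B)) b f x s :
  c = Con SRec $ b $ f -> eqv Hs (c $ CONS x s) (f $ x $ s $ (c $ s)).
Proof. intros ->; apply srec_cons. Qed.

Section Part.
Context {G : ctx} (Hs : list (fm G)) (X : ty).
Implicit Types (u : tm G (PT X)) (p : tm G (Prod TNat X)) (x : tm G X).

Lemma dom_nil n : eqv Hs (DOM (@Con _ (PT X) Nil) n) O'.
Proof. rewrite (unfold_nil _ Hs _ _ (domT : tm G (Seq _ ~> _)) _ _ eq_refl). bt. reflexivity. Qed.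
Lemma dom_cons p u n :
  eqv Hs (DOM (CONS p u) n) (CMP n (FST p) O' One (DOM u (PM n (FST p)))).
Proof. rewrite (unfold_cons _ Hs _ _ (domT : tm G (Seq _ ~> _)) _ _ _ _ eq_refl). bt. reflexivity. Qed.
Lemma phat_nil n : eqv Hs (HAT (@Con _ (PT X) Nil) n) (can X).
Proof. rewrite (unfold_nil _ Hs _ _ (phatT : tm G (Seq _ ~> _)) _ _ eq_refl). bt. reflexivity. Qed.
Lemma phat_cons p u n :
  eqv Hs (HAT (CONS p u) n) (CMP n (FST p) (can X) (SND p) (HAT u (PM n (FST p)))).
Proof. rewrite (unfold_cons _ Hs _ _ (phatT : tm G (Seq _ ~> _)) _ _ _ _ eq_refl). bt. reflexivity. Qed.
Lemma upd_nil n x : eqv Hs (UPD (Con Nil) n x) (CONS (PAIR n x) (Con Nil)).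
Proof. rewrite (unfold_nil _ Hs _ _ (updT : tm G (Seq _ ~> _)) _ _ eq_refl). bt. reflexivity. Qed.
Lemma upd_cons p u n x : eqv Hs (UPD (CONS p u) n x)
  (CMP n (FST p) (CONS (PAIR n x) (CONS (PAIR (PM (FST p) n) (SND p)) u)) (CONS p u)
    (CONS p (UPD u (PM n (FST p)) x))).
Proof. rewrite (unfold_cons _ Hs _ _ (updT : tm G (Seq _ ~> _)) _ _ _ _ eq_refl). bt. reflexivity. Qed.
End Part.

Tactic Notation "tri_elim" constr(m) constr(n) ident(d) ident(E) :=
  let C := fresh in
  lazymatch goal with
  | |- prv _ ?K _ => pose proof (tri _ K m n) as C
  | |- eqv ?K _ _ => pose proof (tri _ K m n) as C
  end;
  or_elim C as E; [ex_elim E as d E|or_elim E as E; [|ex_elim E as d E]].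

(** Membership in the domain is thereby decidable, and its negation turns into an equation that can
    be rewritten with. *)
Lemma dom_bit G (Hs : list (fm G)) X (u : tm G (PT X)) n :
  prv T Hs (Or (Eq (DOM u n) O') (Eq (DOM u n) One)).
Proof.
  assert (H : prv T Hs (All (PT X) (All TNat (Or (Eq (DOM v1 v0) O') (Eq (DOM v1 v0) One))))).
  - seq_elim p u' IH.
    + all_intro m. or_l. apply dom_nil.
    + all_intro m. tri_elim m (FST p) d E.
      * or_l. rewrite dom_cons, (cmp_lt E). reflexivity.
      * or_r. rewrite dom_cons, (cmp_eq E). reflexivity.
      * spec IH d. or_elim IH as IH; [or_l|or_r];
        rewrite dom_cons, (cmp_gt E), (gap E); exact IH.
  - spec H u. spec H n. exact H.
Qed.
Ltac absurd' H := apply p_botE; eapply p_impE; [exact H|]; eqv_fold.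

(** One proof for the domain and for the extension: [F] is any lookup with default [z] that returns
    [g] of the stored value on a hit. The update only recodes gaps, which a lookup elsewhere does
    not notice. The equations for [F] are object formulas so that they can be transferred to other
    contexts. *)
Lemma look_upd_other G (Hs : list (fm G)) X B (F : tm G (PT X ~> TNat ~> B)) z (g : tm G (X ~> B))
  u n x j :
  prv T Hs (All TNat (Eq (wk _ F $ Con Nil $ v0) (wk _ z))) ->
  prv T Hs (All (Prod TNat X) (All (PT X) (All TNat (Eq
    (wk _ (wk _ (wk _ F)) $ CONS v2 v1 $ v0)
    (CMP v0 (FST v2) (wk _ (wk _ (wk _ z))) (wk _ (wk _ (wk _ g)) $ SND v2)
      (wk _ (wk _ (wk _ F)) $ v1 $ (PM v0 (FST v2)))))))) ->
  prv T Hs (Neg (Eq j n)) ->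
  eqv Hs (F $ UPD u n x $ j) (F $ u $ j).
Proof.
  intros F0 F1 N. simp_in F0. simp_in F1. simp_in N.
  assert (H : prv T Hs (All (PT X) (All TNat (All X (All TNat (Imp (Neg (Eq v0 v2))
    (Eq (wk _ (wk _ (wk _ (wk _ F))) $ UPD v3 v2 v1 $ v0) (wk _ (wk _ (wk _ (wk _ F))) $ v3 $ v0)))))))).
  2:{ spec H u. spec H n. spec H x. spec H j. exact (p_impE H N). }
  clear N u n x j.
  seq_elim p u IH.
  - all_intro n. all_intro x. all_intro j. imp_intro N.
    rewrite upd_nil.
    spec F0 j as E0. spec F0 (PM j n) as E0'.
    spec F1 (PAIR n x) as E1. spec E1 (@Con G (PT X) Nil). spec E1 j.
    rewrite E1, fst_pair, E0, E0'. tri_elim j n d E.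
    + apply (cmp_lt E).
    + absurd' N. exact E.
    + apply (cmp_gt E).
  - all_intro n. all_intro x. all_intro j. imp_intro N.
    rewrite upd_cons.
    spec F1 p as E1. spec E1 u. spec E1 j.
    rewrite E1. tri_elim n (FST p) d E.
    (* The new entry comes before the head and splits its gap, leaving [d] for the old head. *)
    + rewrite (cmp_lt E), (gap E).
      spec F1 (PAIR n x) as E2. spec E2 (CONS (PAIR d (SND p)) u). spec E2 j.
      rewrite E2, fst_pair. tri_elim j n e E'.
      * rewrite (cmp_lt E').
        rewrite E', <- add_assoc, S_add in E. rewrite (cmp_lt E). reflexivity.
      * absurd' N. exact E'.
      (* Beyond [n] both the sought position and the old head are shifted by n + 1, so all
         comparisons agree with the original ones. *)
      * rewrite (cmp_gt E'), (gap E').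
        spec F1 (PAIR d (SND p)) as E3. spec E3 u. spec E3 e.
        rewrite E3, fst_pair, snd_pair, E, E', !monus_add_add, !monus_SS. reflexivity.
    + rewrite (cmp_eq E). exact E1.
    + rewrite (cmp_gt E), (gap E).
      spec F1 p as E2. spec E2 (UPD u d x). spec E2 j.
      rewrite E2. tri_elim j (FST p) e E'.
      * rewrite !(cmp_lt E'). reflexivity.
      * rewrite !(cmp_eq E'). reflexivity.
      * rewrite !(cmp_gt E'), (gap E').
        spec IH d. spec IH x. spec IH e. apply (p_impE IH).
        imp_intro Q. simp_in Q. absurd' N. rewrite E', E, Q. reflexivity.
Qed.

Lemma dom_upd_other G (Hs : list (fm G)) X (u : tm G (PT X)) n x j :
  prv T Hs (Neg (Eq j n)) -> eqv Hs (DOM (UPD u n x) j) (DOM u j).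
Proof.
  intros N. apply (look_upd_other _ _ _ _ _ O' (Lam One)); [| |exact N].
  - all_intro k. apply dom_nil.
  - all_intro p. all_intro v. all_intro k. rewrite beta. simp. apply dom_cons.
Qed.
Arguments dom_upd_other {G Hs X u n x j}.

Lemma phat_upd_other G (Hs : list (fm G)) X (u : tm G (PT X)) n x j :
  prv T Hs (Neg (Eq j n)) -> eqv Hs (HAT (UPD u n x) j) (HAT u j).
Proof.
  intros N. apply (look_upd_other _ _ _ _ _ (can X) (Lam v0)); [| |exact N].
  - all_intro k. apply phat_nil.
  - all_intro p. all_intro v. all_intro k. rewrite beta. simp. apply phat_cons.
Qed.

Lemma dom_upd_same G (Hs : list (fm G)) X (u : tm G (PT X)) n x :
  eqv Hs (DOM (UPD u n x) n) One.
Proof.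
  assert (H : prv T Hs (All (PT X) (All TNat (All X (Eq (DOM (UPD v2 v1 v0) v1) One))))).
  2:{ spec H u. spec H n. spec H x. exact H. }
  clear n u x. seq_elim p u IH.
  - all_intro n. all_intro x. rewrite upd_nil, dom_cons, fst_pair.
    apply cmp_eq. reflexivity.
  - all_intro n. all_intro x. rewrite upd_cons. tri_elim n (FST p) d E.
    + rewrite (cmp_lt E), dom_cons, fst_pair. apply cmp_eq; reflexivity.
    + rewrite (cmp_eq E), dom_cons. apply cmp_eq; exact E.
    + rewrite (cmp_gt E), dom_cons, (cmp_gt E), (gap E).
      spec IH d. spec IH x. exact IH.
Qed.

Lemma phat_upd_same G (Hs : list (fm G)) X (u : tm G (PT X)) n x :
  eqv Hs (DOM u n) O' -> eqv Hs (HAT (UPD u n x) n) x.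
Proof.
  intros K.
  assert (H : prv T Hs (All (PT X) (All TNat (All X
    (Imp (Eq (DOM v2 v1) O') (Eq (HAT (UPD v2 v1 v0) v1) v0)))))).
  2:{ spec H u. spec H n. spec H x. exact (p_impE H K). }
  clear K n u x. seq_elim p u IH.
  - all_intro n. all_intro x. imp_intro K. rewrite upd_nil, phat_cons, fst_pair, snd_pair.
    apply cmp_eq. reflexivity.
  - all_intro n. all_intro x. imp_intro K. rewrite upd_cons. rewrite dom_cons in K.
    tri_elim n (FST p) d E.
    + rewrite (cmp_lt E), phat_cons, fst_pair, snd_pair. apply cmp_eq; reflexivity.
    + rewrite (cmp_eq E) in K. apply (S_neq_0 K).
    + rewrite (cmp_gt E), (gap E) in K.
      rewrite (cmp_gt E), phat_cons, (cmp_gt E), (gap E).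
      spec IH d. spec IH x. exact (p_impE IH K).
Qed.
Arguments phat_upd_same {G Hs X u n x}.

Lemma phat_undef G (Hs : list (fm G)) X (u : tm G (PT X)) n :
  eqv Hs (DOM u n) O' -> eqv Hs (HAT u n) (can X).
Proof.
  intros K.
  assert (H : prv T Hs (All (PT X) (All TNat (Imp (Eq (DOM v1 v0) O') (Eq (HAT v1 v0) (can X)))))).
  2:{ spec H u. spec H n. exact (p_impE H K). }
  clear K n u. seq_elim p u IH.
  - all_intro n. imp_intro K. apply phat_nil.
  - all_intro n. imp_intro K. rewrite dom_cons in K. rewrite phat_cons.
    tri_elim n (FST p) d E.
    + apply (cmp_lt E).
    + rewrite (cmp_eq E) in K. apply (S_neq_0 K).
    + rewrite (cmp_gt E), (gap E) in K.
      rewrite (cmp_gt E), (gap E).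
      spec IH d. exact (p_impE IH K).
Qed.
Arguments phat_undef {G Hs X u n}.

(** An equality of codes, not just of values; it is the reason why a stopped process stays where it
    is. *)
Lemma upd_defined G (Hs : list (fm G)) X (u : tm G (PT X)) n x :
  eqv Hs (DOM u n) One -> eqv Hs (UPD u n x) u.
Proof.
  intros K.
  assert (H : prv T Hs (All (PT X) (All TNat (All X
    (Imp (Eq (DOM v2 v1) One) (Eq (UPD v2 v1 v0) v2)))))).
  2:{ spec H u. spec H n. spec H x. exact (p_impE H K). }
  clear K n u x. seq_elim p u IH.
  - all_intro n. all_intro x. imp_intro K. rewrite dom_nil in K.
    symmetry in K. apply (S_neq_0 K).
  - all_intro n. all_intro x. imp_intro K. rewrite upd_cons. rewrite dom_cons in K.
    tri_elim n (FST p) d E.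
    + rewrite (cmp_lt E) in K. symmetry in K. apply (S_neq_0 K).
    + apply (cmp_eq E).
    + rewrite (cmp_gt E), (gap E) in K.
      rewrite (cmp_gt E), (gap E).
      spec IH d. spec IH x. rewrite (p_impE IH K : eqv Hs _ _). reflexivity.
Qed.
Arguments upd_defined {G Hs X u n x}.

Lemma nat_dec G (Hs : list (fm G)) (j n : tm G TNat) : prv T Hs (Or (Eq j n) (Neg (Eq j n))).
Proof.
  tri_elim j n d E.
  - or_r. imp_intro Q. rewrite Q in E.
    (* Subtracting [n] from n = n + (d + 1) leaves 0 = d + 1. *)
    pose proof (monus_add_l _ Hs n (S' d)) as M. rewrite <- E, monus_self in M.
    symmetry in M. apply (S_neq_0 M).
  - or_l. exact E.
  - or_r. imp_intro Q. rewrite Q in E.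
    pose proof (monus_add_l _ Hs n (S' d)) as M. rewrite <- E, monus_self in M.
    symmetry in M. apply (S_neq_0 M).
Qed.

Tactic Notation "dec_elim" constr(m) constr(n) ident(E) :=
  let C := fresh in
  lazymatch goal with
  | |- prv _ ?K _ => pose proof (nat_dec _ K m n) as C
  | |- eqv ?K _ _ => pose proof (nat_dec _ K m n) as C
  end;
  or_elim C as E.

Tactic Notation "bit_elim" constr(u) constr(n) ident(E) :=
  let C := fresh in
  lazymatch goal with
  | |- prv _ ?K _ => pose proof (dom_bit _ K _ u n) as C
  | |- eqv ?K _ _ => pose proof (dom_bit _ K _ u n) as C
  end;
  or_elim C as E.

Tactic Notation "nat_cases" constr(n) ident(m) ident(E) :=
  let C := fresh in
  lazymatch goal with
  | |- prv _ ?K _ => pose proof (nat_case _ K n) as C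
  | |- eqv ?K _ _ => pose proof (nat_case _ K n) as C
  end;
  or_elim C as E; [|ex_elim E as m E].

Lemma dom_persist G (Hs : list (fm G)) X (w : tm G (PT X)) n x j :
  eqv Hs (DOM w j) One -> eqv Hs (DOM (UPD w n x) j) One.
Proof.
  intros D. dec_elim j n E.
  - rewrite E. apply dom_upd_same.
  - rewrite (dom_upd_other E). exact D.
Qed.

Lemma phat_persist G (Hs : list (fm G)) X (w : tm G (PT X)) n x j :
  eqv Hs (DOM w j) One -> eqv Hs (HAT (UPD w n x) j) (HAT w j).
Proof.
  intros D. dec_elim j n E.
  - rewrite E in D. rewrite upd_defined by exact D. reflexivity.
  - apply phat_upd_other. exact E.
Qed.

(** * The process generated by phi *)

(** [ST] is the stop test: 1 if the position [w] is stopped, 0 if play goes on from it. *)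
Notation STEP f w x := (UPD w (f $ PHAT w) x).
Notation ST f w := (DOM w (f $ PHAT w)).
Notation LEN s := (lenT $ s).
Notation SNOC s z := (snocT $ s $ z).
Notation CTRL X := ((TNat ~> X) ~> TNat).

(** * Finite sequences and their partial sums *)

Section Lists.
Context {G : ctx} (Hs : list (fm G)) (A : ty).
Implicit Types (s : tm G (Seq A)) (x z : tm G A).
Lemma len_nil : eqv Hs (LEN (@Con G (Seq A) Nil)) O'.
Proof. unfold lenT. apply srec_nil. Qed.
Lemma len_cons x s : eqv Hs (LEN (CONS x s)) (S' LEN s).
Proof. rewrite (unfold_cons _ Hs _ _ (lenT : tm G (Seq A ~> _)) _ _ _ _ eq_refl). bt. reflexivity. Qed.
Lemma snoc_nil z : eqv Hs (SNOC (Con Nil) z) (CONS z (Con Nil)).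
Proof. unfold snocT. bt. apply srec_nil. Qed.
Lemma snoc_cons x s z : eqv Hs (SNOC (CONS x s) z) (CONS x (SNOC s z)).
Proof. unfold snocT. bt. rewrite srec_cons. bt. reflexivity. Qed.
Lemma shat_nil n : eqv Hs (SHAT (@Con G (Seq A) Nil) $ n) (can A).
Proof. rewrite (unfold_nil _ Hs _ _ (shatT : tm G (Seq A ~> _)) _ _ eq_refl). bt. reflexivity. Qed.
Lemma shat_0 x s : eqv Hs (SHAT (CONS x s) $ O') x.
Proof. rewrite (unfold_cons _ Hs _ _ (shatT : tm G (Seq A ~> _)) _ _ _ _ eq_refl). bt. apply rec_0. Qed.
Lemma shat_S x s n : eqv Hs (SHAT (CONS x s) $ (S' n)) (SHAT s $ n).
Proof.
  rewrite (unfold_cons _ Hs _ _ (shatT : tm G (Seq A ~> _)) _ _ _ _ eq_refl). bt.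
  rewrite rec_S. bt. reflexivity.
Qed.
End Lists.

Lemma len_snoc G (Hs : list (fm G)) A s (z : tm G A) : eqv Hs (LEN (SNOC s z)) (S' LEN s).
Proof.
  assert (H : prv T Hs (All (Seq A) (Eq (LEN (SNOC v0 (wk _ z))) (S' LEN v0)))).
  2:{ spec H s. exact H. }
  seq_elim x t IH.
  - rewrite snoc_nil, len_cons. reflexivity.
  - rewrite snoc_cons, !len_cons, IH. reflexivity.
Qed.

Lemma shat_snoc_lt G (Hs : list (fm G)) A s (z : tm G A) j d :
  eqv Hs (LEN s) (j ⊹ (S' d)) -> eqv Hs (SHAT (SNOC s z) $ j) (SHAT s $ j).
Proof.
  intros K.
  assert (H : prv T Hs (All (Seq A) (All TNat (All TNat (Imp (Eq (LEN v2) (v1 ⊹ (S' v0)))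
    (Eq (SHAT (SNOC v2 (wk _ (wk _ (wk _ z)))) $ v1) (SHAT v2 $ v1))))))).
  2:{ spec H s. spec H j. spec H d. exact (p_impE H K). }
  clear K j d s. seq_elim x t IH.
  - all_intro j. all_intro d. imp_intro K. rewrite add_S, len_nil in K.
    symmetry in K. apply (S_neq_0 K).
  - all_intro j. all_intro d. imp_intro K. rewrite snoc_cons.
    nat_cases j k E.
    + rewrite E, !shat_0. reflexivity.
    + rewrite E, !shat_S. rewrite E, len_cons, S_add in K. apply S_inj in K.
      spec IH k. spec IH d. exact (p_impE IH K).
Qed.

Lemma shat_snoc_len G (Hs : list (fm G)) A s (z : tm G A) : eqv Hs (SHAT (SNOC s z) $ LEN s) z.
Proof.
  assert (H : prv T Hs (All (Seq A) (Eq (SHAT (SNOC v0 (wk _ z)) $ LEN v0) (wk _ z)))).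
  2:{ spec H s. exact H. }
  seq_elim x t IH.
  - rewrite snoc_nil, len_nil. apply shat_0.
  - rewrite snoc_cons, len_cons, shat_S. exact IH.
Qed.

Lemma shat_ge G (Hs : list (fm G)) A (s : tm G (Seq A)) d : eqv Hs (SHAT s $ (LEN s ⊹ d)) (can A).
Proof.
  assert (H : prv T Hs (All (Seq A) (Eq (SHAT v0 $ (LEN v0 ⊹ wk _ d)) (can A)))).
  2:{ spec H s. exact H. }
  seq_elim x t IH.
  - apply shat_nil.
  - rewrite len_cons, S_add, shat_S. exact IH.
Qed.

(** Entries of a guess are increments of stages rather than stages. The stages guessed for positions
    0, 1, ... are therefore nondecreasing, and a later one retains whatever an earlier one has
    filled. *)
Definition sumT0 : tm [] ((TNat ~> TNat) ~> TNat ~> TNat) :=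
  Lam (Con Rec $ O' $ Lam (Lam (v0 ⊹ (v2 $ v1)))).
Notation SUM g n := (closed sumT0 $ g $ n).

Lemma sum_0 G (Hs : list (fm G)) g : eqv Hs (SUM g O') O'.
Proof. unfold_closed sumT0 sumT0. bt. apply rec_0. Qed.

Lemma sum_S G (Hs : list (fm G)) g n : eqv Hs (SUM g (S' n)) (SUM g n ⊹ (g $ n)).
Proof. unfold_closed sumT0 sumT0. bt. rewrite rec_S. bt. reflexivity. Qed.

Lemma sum_add G (Hs : list (fm G)) g n d :
  prv T Hs (Ex TNat (Eq (wk _ (SUM g (n ⊹ d))) (wk _ (SUM g n) ⊹ v0))).
Proof.
  assert (H : prv T Hs (All TNat (Ex TNat (Eq (SUM (wk _ (wk _ g)) (wk _ (wk _ n) ⊹ v1))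
    (SUM (wk _ (wk _ g)) (wk _ (wk _ n)) ⊹ v0))))).
  2:{ spec H d. exact H. }
  nat_elim k IH.
  - ex (O' : tm G TNat). rewrite !add_0. reflexivity.
  - ex_elim IH as e IH. ex (e ⊹ (g $ (n ⊹ k))).
    rewrite add_S, sum_S, IH, add_assoc. reflexivity.
Qed.

Lemma sum_shat_ge G (Hs : list (fm G)) s d :
  eqv Hs (SUM (SHAT s) (LEN s ⊹ d)) (SUM (SHAT s) (LEN s)).
Proof.
  assert (H : prv T Hs (All TNat (Eq (SUM (SHAT (wk _ s)) (LEN (wk _ s) ⊹ v0))
     (SUM (SHAT (wk _ s)) (LEN (wk _ s)))))).
  2:{ spec H d. exact H. }
  nat_elim k IH.
  - rewrite add_0. reflexivity.
  (* The default element of [TNat] is zero, so nothing is added beyond the end of [s]. *)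
  - rewrite add_S, sum_S, shat_ge. simp. rewrite add_0. exact IH.
Qed.

Lemma sum_shat_snoc_le G (Hs : list (fm G)) s z n d : eqv Hs (LEN s) (n ⊹ d) ->
  eqv Hs (SUM (SHAT (SNOC s z)) n) (SUM (SHAT s) n).
Proof.
  intros K.
  assert (H : prv T Hs (All TNat (All TNat (Imp (Eq (LEN (wk _ (wk _ s))) (v1 ⊹ v0))
    (Eq (SUM (SHAT (SNOC (wk _ (wk _ s)) (wk _ (wk _ z)))) v1) (SUM (SHAT (wk _ (wk _ s))) v1)))))).
  2:{ spec H n. spec H d. exact (p_impE H K). }
  clear K n d. nat_elim k IH.
  - all_intro d. imp_intro K. rewrite !sum_0. reflexivity.
  - all_intro d. imp_intro K. rewrite !sum_S. rewrite S_add, <- add_S in K.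
    spec IH (S' d). rewrite (p_impE IH K : eqv Hs _ _), (shat_snoc_lt _ _ _ _ _ _ _ K). reflexivity.
Qed.

Lemma sum_shat_snoc G (Hs : list (fm G)) s z :
  eqv Hs (SUM (SHAT (SNOC s z)) (S' LEN s)) (SUM (SHAT s) (LEN s) ⊹ z).
Proof.
  rewrite sum_S, shat_snoc_len, (sum_shat_snoc_le _ _ _ _ _ O'); [reflexivity|].
  rewrite add_0. reflexivity.
Qed.

(** The sequence of the V_i started at [u]. It has no stop test: at a stopped position the update
    changes nothing. *)
Definition iterT0 X : tm [] (CTRL X ~> PT X ~> (TNat ~> X) ~> TNat ~> PT X) :=
  Lam (Lam (Lam (Con Rec $ v1 $ Lam (Lam (STEP v4 v0 (v2 $ v1)))))).
Notation ITER f u b i := (closed (iterT0 _) $ f $ u $ b $ i).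

Lemma iter_0 G (Hs : list (fm G)) X (f : tm G (CTRL X)) u b : eqv Hs (ITER f u b O') u.
Proof. unfold_closed (iterT0 X) iterT0. bt. apply rec_0. Qed.

Lemma iter_S G (Hs : list (fm G)) X (f : tm G (CTRL X)) u b i :
  eqv Hs (ITER f u b (S' i)) (STEP f (ITER f u b i) (b $ i)).
Proof. unfold_closed (iterT0 X) iterT0. bt. rewrite rec_S. bt. reflexivity. Qed.

Lemma iter_dom_mono G (Hs : list (fm G)) X (f : tm G (CTRL X)) u b i d j :
  eqv Hs (DOM (ITER f u b i) j) One -> eqv Hs (DOM (ITER f u b (i ⊹ d)) j) One.
Proof.
  intros K.
  assert (H : prv T Hs (All TNat (Eq (DOM (ITER (wk _ f) (wk _ u) (wk _ b) (wk _ i ⊹ v0)) (wk _ j)) One))).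
  2:{ spec H d. exact H. }
  nat_elim k IH.
  - rewrite add_0. exact K.
  - rewrite add_S, iter_S. apply dom_persist, IH.
Qed.

Lemma iter_phat_mono G (Hs : list (fm G)) X (f : tm G (CTRL X)) u b i d j :
  eqv Hs (DOM (ITER f u b i) j) One ->
  eqv Hs (HAT (ITER f u b (i ⊹ d)) j) (HAT (ITER f u b i) j).
Proof.
  intros K.
  assert (H : prv T Hs (All TNat (Eq (HAT (ITER (wk _ f) (wk _ u) (wk _ b) (wk _ i ⊹ v0)) (wk _ j))
    (HAT (ITER (wk _ f) (wk _ u) (wk _ b) (wk _ i)) (wk _ j))))).
  2:{ spec H d. exact H. }
  nat_elim k IH.
  - rewrite add_0. reflexivity.
  - rewrite add_S, iter_S, phat_persist; [exact IH|]. apply iter_dom_mono, K.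
Qed.

Lemma iter_stuck G (Hs : list (fm G)) X (f : tm G (CTRL X)) u b i d :
  eqv Hs (ST f (ITER f u b i)) One -> eqv Hs (ITER f u b (i ⊹ d)) (ITER f u b i).
Proof.
  intros K.
  assert (H : prv T Hs (All TNat (Eq (ITER (wk _ f) (wk _ u) (wk _ b) (wk _ i ⊹ v0))
    (ITER (wk _ f) (wk _ u) (wk _ b) (wk _ i))))).
  2:{ spec H d. exact H. }
  nat_elim k IH.
  - rewrite add_0. reflexivity.
  - rewrite add_S, iter_S, IH. apply upd_defined, K.
Qed.

Lemma zero_one G (Hs : list (fm G)) (n : tm G TNat) P : eqv Hs n O' -> eqv Hs n One -> prv T Hs P.
Proof. intros H K. rewrite H in K. symmetry in K. apply (S_neq_0 K). Qed.
Arguments zero_one {G Hs n P}.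

Lemma iter_dom_back G (Hs : list (fm G)) X (f : tm G (CTRL X)) u b i d j :
  eqv Hs (DOM (ITER f u b (i ⊹ d)) j) O' -> eqv Hs (DOM (ITER f u b i) j) O'.
Proof.
  intros K. bit_elim (ITER f u b i) j E; [exact E|].
  apply (zero_one K). apply iter_dom_mono, E.
Qed.

Lemma iter_run_back G (Hs : list (fm G)) X (f : tm G (CTRL X)) u b i d :
  eqv Hs (ST f (ITER f u b (i ⊹ d))) O' -> eqv Hs (ST f (ITER f u b i)) O'.
Proof.
  intros K. bit_elim (ITER f u b i) (f $ PHAT (ITER f u b i)) E; [exact E|].
  rewrite iter_stuck in K by exact E. apply (zero_one K E).
Qed.

(** * Spector's equation as two rules *)

Section BR.
Context {G : ctx} (Hs : list (fm G)) (Z S : ty).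
Context (f : tm G (Seq Z ~> (Z ~> S) ~> S)) (b : tm G (Seq Z ~> S)) (c : tm G (CTRL Z)) (s : tm G (Seq Z)).

Lemma br_cases : prv T Hs (EqCases (Con (BR Z S) $ f $ b $ c $ s) (Lt (c $ SHAT s) (LEN s))
  (b $ s) (f $ s $ Lam (Con (BR Z S) $ wk _ f $ wk _ b $ wk _ c $ SNOC (wk _ s) v0))).
Proof.
  assert (H : prv T Hs (BR_eqn Z S)) by (apply p_ax; right; constructor).
  unfold BR_eqn in H. simp_in H. spec H f. spec H b. spec H c. spec H s.
  simp. exact H.
Qed.

Lemma br_leaf : eqv Hs (monusT $ (S' (c $ SHAT s)) $ LEN s) O' ->
  eqv Hs (Con (BR Z S) $ f $ b $ c $ s) (b $ s).
Proof. intros H. pose proof (p_andL br_cases) as C. exact (p_impE C H). Qed.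

Lemma br_node : prv T Hs (Neg (Eq (monusT $ (S' (c $ SHAT s)) $ LEN s) O')) ->
  eqv Hs (Con (BR Z S) $ f $ b $ c $ s)
    (f $ s $ Lam (Con (BR Z S) $ wk _ f $ wk _ b $ wk _ c $ SNOC (wk _ s) v0)).
Proof. intros H. pose proof (p_andR br_cases) as C. exact (p_impE C H). Qed.
End BR.

Lemma lt_ex G (Hs : list (fm G)) m n : eqv Hs (monusT $ (S' m) $ n) O' ->
  prv T Hs (Ex TNat (Eq (wk _ n) (wk _ m ⊹ (S' v0)))).
Proof.
  intros H. tri_elim m n d E.
  - ex d. exact E.
  - rewrite E, <- (zero_add _ n) in H at 1. 
    rewrite <- S_add, add_comm, monus_add_l in H. apply (S_neq_0 H).
  - rewrite E, <- add_S, monus_add_l in H. apply (S_neq_0 H).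
Qed.
Arguments lt_ex {G Hs m n}.

(** * Searching for a stopping stage *)

(* The last argument of BR is phi at the guessed limit; the successors make the
   value at a node exceed the values at the two extensions that it uses. *)
Definition searchT0 X : tm [] (CTRL X ~> PT X ~> (TNat ~> X) ~> Seq TNat ~> TNat) :=
  Lam (Lam (Lam (Con (BR TNat TNat)
    $ Lam (Lam (S' ((v0 $ O') ⊹ (v0 $ (v0 $ O')))))
    $ Lam (S' SUM (SHAT v0) (LEN v0))
    $ Lam (v3 $ Lam (HAT (ITER v4 v3 v2 (SUM v1 (S' v0))) v0))))).
Notation SEARCH f u b s := (closed (searchT0 _) $ f $ u $ b $ s).
(** The guessed limit stream. Beyond the end of [s] the sum no longer grows, so there the stream
    reads the stage given by the sum of all entries. *)
Notation GUESS f u b s :=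
  (Lam (HAT (ITER (wk _ f) (wk _ u) (wk _ b) (SUM (SHAT (wk _ s)) (S' v0))) v0)).

Lemma search_leaf G (Hs : list (fm G)) X (f : tm G (CTRL X)) u b s :
  eqv Hs (monusT $ (S' (f $ GUESS f u b s)) $ LEN s) O' ->
  eqv Hs (SEARCH f u b s) (S' SUM (SHAT s) (LEN s)).
Proof.
  intros H. unfold_closed (searchT0 X) searchT0. bt. rewrite br_leaf; [bt; reflexivity|].
  bt. simp_in H. exact H.
Qed.
Arguments search_leaf {G Hs X f u b s}.

Lemma search_node G (Hs : list (fm G)) X (f : tm G (CTRL X)) u b s :
  prv T Hs (Neg (Eq (monusT $ (S' (f $ GUESS f u b s)) $ LEN s) O')) ->
  eqv Hs (SEARCH f u b s)
    (S' (SEARCH f u b (SNOC s O') ⊹ SEARCH f u b (SNOC s (SEARCH f u b (SNOC s O'))))).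
Proof.
  intros H. simp_in H. unfold_closed (searchT0 X) searchT0. bt. rewrite br_node; [bt; reflexivity|].
  simp. imp_intro K. rewrite beta in K; simp_in K. exact (p_impE H K).
Qed.
Arguments search_node {G Hs X f u b s}.

(* The guess s is not refuted by stage i. *)
Definition noref {G X} (f : tm G (CTRL X)) u b s i : fm G :=
  All TNat (All TNat (Imp (Eq (LEN (wk _ (wk _ s))) (v1 ⊹ (S' v0)))
  (Imp (Eq (DOM (ITER (wk _ (wk _ f)) (wk _ (wk _ u)) (wk _ (wk _ b)) (wk _ (wk _ i))) v1) One)
    (Eq (DOM (ITER (wk _ (wk _ f)) (wk _ (wk _ u)) (wk _ (wk _ b))
      (SUM (SHAT (wk _ (wk _ s))) (S' v1))) v1) One)))).

Lemma fsub_noref G D X (f : tm G (CTRL X)) u b s i (e : smap G D) :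
  fsub (noref f u b s i) e = noref (sub f e) (sub u e) (sub b e) (sub s e) (sub i e).
Proof. unfold noref; simp. reflexivity. Qed.

Ltac sb_ext ::= match goal with |- context [fsub (noref _ _ _ _ _) _] => rewrite fsub_noref end.
Ltac sb_ext_in H ::= match type of H with context [fsub (noref _ _ _ _ _) _] => rewrite fsub_noref in H end.

Lemma noref_elim G (Hs : list (fm G)) X (f : tm G (CTRL X)) u b s i j d :
  prv T Hs (noref f u b s i) -> eqv Hs (LEN s) (j ⊹ (S' d)) ->
  eqv Hs (DOM (ITER f u b i) j) One -> eqv Hs (DOM (ITER f u b (SUM (SHAT s) (S' j))) j) One.
Proof.
  intros N E D. unfold noref in N. simp_in N. spec N j. spec N d. exact (p_impE (p_impE N E) D).
Qed.
Arguments noref_elim {G Hs X f u b s i j d}.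

(** Let N be the sum of [s]. A position below |s| that is empty in V_N is empty at its earlier
    guessed stage, and both streams give the default. If it is filled in V_N, hence in V_{N+1}, then
    by the premise it was filled at its guessed stage, and values persist. From |s| on, the guessed
    stage is N itself. *)
Lemma guess_eqv G (Hs : list (fm G)) X (f : tm G (CTRL X)) u b s :
  prv T Hs (noref f u b s (S' SUM (SHAT s) (LEN s))) ->
  eqv Hs (GUESS f u b s) (PHAT (ITER f u b (SUM (SHAT s) (LEN s)))).
Proof.
  intros N. apply ext; intros D Ks n r W. push W. bt.
  tri_elim n (LEN s) d E.
  - assert (E' : eqv Hs (LEN s) ((S' n) ⊹ d)) by (rewrite S_add, <- add_S; exact E).
    pose proof (sum_add _ Hs (SHAT s) (S' n) d) as C. simp_in C. ex_elim C as e Q.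
    rewrite <- E' in Q.
    bit_elim (ITER f u b (SUM (SHAT s) (LEN s))) n K.
    + rewrite (phat_undef K). apply phat_undef.
      apply iter_dom_back with e. rewrite <- Q. exact K.
    + rewrite Q. rewrite iter_phat_mono; [reflexivity|].
      apply (noref_elim N E). rewrite iter_S. apply dom_persist, K.
  - rewrite E at 1 2. rewrite <- (add_0 _ (LEN s)) at 1. rewrite <- add_S, sum_shat_ge.
    rewrite E at 1. reflexivity.
  - rewrite E at 1. rewrite <- add_S, sum_shat_ge. reflexivity.
Qed.

(** With N the sum of [s], [guess_eqv] puts k, the value of [f] at the extension of V_N, below |s|.
    If V_N is not stopped, k is empty in V_N but filled in V_{N+1}; as the guess for k stands, k was
    filled by some stage up to N, a contradiction. If V_N is stopped, so is V_{N+1}. This is why a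
    leaf returns N + 1. *)
Lemma search_leaf_sound G (Hs : list (fm G)) X (f : tm G (CTRL X)) u b s :
  eqv Hs (monusT $ (S' (f $ GUESS f u b s)) $ LEN s) O' ->
  eqv Hs (ST f (ITER f u b (S' SUM (SHAT s) (LEN s)))) O' ->
  prv T Hs (noref f u b s (S' SUM (SHAT s) (LEN s))) -> prv T Hs Bot.
Proof.
  intros L H N. simp_in L. pose proof (guess_eqv _ Hs _ f u b s) as E. simp_in E. specialize (E N). rewrite E in L. clear E.
  apply lt_ex in L. simp_in L. ex_elim L as d L.
  bit_elim (ITER f u b (SUM (SHAT s) (LEN s))) (f $ PHAT (ITER f u b (SUM (SHAT s) (LEN s)))) K.
  - assert (E' : eqv Hs (LEN s) ((S' (f $ PHAT (ITER f u b (SUM (SHAT s) (LEN s))))) ⊹ d))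
      by (rewrite S_add, <- add_S; exact L).
    pose proof (sum_add _ Hs (SHAT s) (S' (f $ PHAT (ITER f u b (SUM (SHAT s) (LEN s))))) d) as C.
    simp_in C. ex_elim C as e Q. rewrite <- E' in Q.
    apply (zero_one K). rewrite Q at 1. apply iter_dom_mono.
    apply (noref_elim N L). rewrite iter_S. apply dom_upd_same.
  - rewrite iter_S, upd_defined in H by exact K. exact (zero_one H K).
Qed.
Arguments search_leaf_sound {G Hs X f u b s}.

(** Were the later stage S (r1 + r2) unstopped and [s] unrefuted by it, stages r1 and r2 would be
    unstopped too. It then suffices that r2 refutes no guess of [s] extended by r1: old guesses
    survive by monotonicity, and the new one is settled by what r1 says about [s] extended by 0. *)
Lemma search_node_sound G (Hs : list (fm G)) X (f : tm G (CTRL X)) u b s r1 r2 :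
  prv T Hs (Imp (Eq (ST f (ITER f u b r1)) O') (Imp (noref f u b (SNOC s O') r1) Bot)) ->
  prv T Hs (Imp (Eq (ST f (ITER f u b r2)) O') (Imp (noref f u b (SNOC s r1) r2) Bot)) ->
  eqv Hs (ST f (ITER f u b (S' (r1 ⊹ r2)))) O' ->
  prv T Hs (noref f u b s (S' (r1 ⊹ r2))) -> prv T Hs Bot.
Proof.
  intros H1 H2 H N.
  assert (Q1 : eqv Hs (S' (r1 ⊹ r2)) (r1 ⊹ (S' r2))) by (rewrite add_S; reflexivity).
  assert (Q2 : eqv Hs (S' (r1 ⊹ r2)) (r2 ⊹ (S' r1))) by (rewrite add_S, add_comm; reflexivity).
  apply (p_impE (p_impE H2 (iter_run_back _ _ _ _ _ _ _ (S' r1) ltac:(rewrite <- Q2; exact H)))).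
  unfold noref. all_intro j. all_intro d. imp_intro E. imp_intro D.
  rewrite len_snoc, add_S in E. apply S_inj in E. nat_cases d k Q.
  (* Here [j] is the new position |s|; its guessed stage is the sum of [s] plus r1, so it is enough
     that V_{r1} fills it. *)
  - rewrite Q, add_0 in E. rewrite <- E. rewrite sum_shat_snoc.
    rewrite <- E in D.
    bit_elim (ITER f u b r1) (LEN s) K; [|rewrite add_comm; apply iter_dom_mono, K].
    (* V_{r1} leaves |s| empty, so r1 cannot refute the new guess 0, and the old guesses stand as
       before. This contradicts the assumption on r1. *)
    apply p_botE, (p_impE (p_impE H1 (iter_run_back _ _ _ _ _ _ _ (S' r2) ltac:(rewrite <- Q1; exact H)))).
    clear E Q d D j. unfold noref. all_intro j. all_intro d. imp_intro E. imp_intro D.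
    rewrite len_snoc, add_S in E. apply S_inj in E. nat_cases d k Q.
    + rewrite Q, add_0 in E. rewrite <- E in D. apply (zero_one K D).
    + rewrite Q in E. rewrite (sum_shat_snoc_le _ _ _ _ _ k) by (rewrite S_add, <- add_S; exact E).
      apply (noref_elim N E). rewrite Q1. apply iter_dom_mono, D.
  - rewrite Q in E. rewrite (sum_shat_snoc_le _ _ _ _ _ k) by (rewrite S_add, <- add_S; exact E).
    apply (noref_elim N E). rewrite Q2. apply iter_dom_mono, D.
Qed.

Lemma search_stops G (Hs : list (fm G)) X (f : tm G (CTRL X)) u b :
  eqv Hs (ST f (ITER f u b (SEARCH f u b (Con Nil)))) One.
Proof.
  (* Induction on a strict bound for the value of the search at an arbitrary guess; the third
     variable is the slack. *)
  assert (H : prv T Hs (All TNat (All (Seq TNat) (All TNat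
    (Imp (Eq v2 (SEARCH (wk _ (wk _ (wk _ f))) (wk _ (wk _ (wk _ u))) (wk _ (wk _ (wk _ b))) v1 ⊹ (S' v0)))
    (Imp (Eq (ST (wk _ (wk _ (wk _ f))) (ITER (wk _ (wk _ (wk _ f))) (wk _ (wk _ (wk _ u))) (wk _ (wk _ (wk _ b)))
       (SEARCH (wk _ (wk _ (wk _ f))) (wk _ (wk _ (wk _ u))) (wk _ (wk _ (wk _ b))) v1))) O')
    (Imp (noref (wk _ (wk _ (wk _ f))) (wk _ (wk _ (wk _ u))) (wk _ (wk _ (wk _ b))) v1
      (SEARCH (wk _ (wk _ (wk _ f))) (wk _ (wk _ (wk _ u))) (wk _ (wk _ (wk _ b))) v1)) Bot))))))).
  { nat_elim n IH.
    - all_intro s. all_intro d. imp_intro E. rewrite add_S in E. symmetry in E. apply (S_neq_0 E).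
    - all_intro s. all_intro d. imp_intro E. imp_intro H. imp_intro N.
      dec_elim (monusT $ (S' (f $ GUESS f u b s)) $ LEN s) (O' : tm G TNat) L.
      + simp_in L. pose proof (search_leaf L) as Q. rewrite Q in H.
        apply (search_leaf_sound L H).
        unfold noref. all_intro j. all_intro e. imp_intro E1. imp_intro D. rewrite <- Q in D.
        apply (noref_elim N E1). exact D.
      + simp_in L. pose proof (search_node L) as Q. rewrite Q in H.
        rewrite Q, add_S in E. apply S_inj in E. rewrite S_add, <- add_S in E.
        eapply (search_node_sound _ _ _ f u b s); [| |exact H|].
        (* With r1 and r2 the two values used at the node, the bound is now n = r1 + r2 + (d + 1).
           The slack is r2 + d for r1 and r1 + d for r2. *)
        * spec IH (SNOC s O').
          spec IH (SEARCH f u b (SNOC s (SEARCH f u b (SNOC s O'))) ⊹ d).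
          simp. apply (p_impE IH); eqv_fold. rewrite E, add_S, <- add_assoc, add_S. reflexivity.
        * spec IH (SNOC s (SEARCH f u b (SNOC s O'))).
          spec IH (SEARCH f u b (SNOC s O') ⊹ d).
          simp. apply (p_impE IH); eqv_fold. rewrite E, (add_comm _ _ (SEARCH f u b (SNOC s O'))), <- add_assoc, add_S.
          rewrite add_S. reflexivity.
        * unfold noref. all_intro j. all_intro e. imp_intro E1. imp_intro D. rewrite <- Q in D.
          apply (noref_elim N E1). exact D. }
  bit_elim (ITER f u b (SEARCH f u b (Con Nil))) (f $ PHAT (ITER f u b (SEARCH f u b (Con Nil)))) E; [|exact E].
  (* The bound is one more than the value; the empty sequence makes no guess that could be
     refuted. *)
  apply p_botE. spec H (SEARCH f u b (Con Nil) ⊹ (S' O')). spec H (@Con G (Seq TNat) Nil). spec H (O' : tm G TNat).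
  apply (p_impE (p_impE (p_impE H (eqv_refl _ _ _)) E)).
  unfold noref. all_intro j. all_intro d. imp_intro L. rewrite len_nil, add_S in L. symmetry in L. apply (S_neq_0 L).
Qed.

(** * The symmetric recursor *)

(** The recursion on the sequence returns a function on positions, so that the head is played
    first. *)
Definition runT0 X : tm [] (CTRL X ~> Seq X ~> PT X ~> PT X) :=
  Lam (Con SRec $ Lam v0 $ Lam (Lam (Lam (Lam (v1 $ STEP v4 v0 v3))))).
Notation RUN f s u := (closed (runT0 _) $ f $ s $ u).

Lemma run_nil G (Hs : list (fm G)) X (f : tm G (CTRL X)) u : eqv Hs (RUN f (Con Nil) u) u.
Proof. unfold_closed (runT0 X) runT0. bt. rewrite srec_nil. bt. reflexivity. Qed.

Lemma run_cons G (Hs : list (fm G)) X (f : tm G (CTRL X)) x s u :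
  eqv Hs (RUN f (CONS x s) u) (RUN f s (STEP f u x)).
Proof. unfold_closed (runT0 X) runT0. bt. rewrite srec_cons. bt. reflexivity. Qed.

Lemma run_snoc G (Hs : list (fm G)) X (f : tm G (CTRL X)) s x u :
  eqv Hs (RUN f (SNOC s x) u) (STEP f (RUN f s u) x).
Proof.
  assert (H : prv T Hs (All (Seq X) (All (PT X) (Eq (RUN (wk _ (wk _ f)) (SNOC v1 (wk _ (wk _ x))) v0)
    (STEP (wk _ (wk _ f)) (RUN (wk _ (wk _ f)) v1 v0) (wk _ (wk _ x))))))).
  2:{ spec H s. spec H u. exact H. }
  clear s u. seq_elim y s IH; all_intro u.
  - rewrite snoc_nil, run_cons, !run_nil. reflexivity.
  - rewrite snoc_cons, !run_cons. spec IH (STEP f u y). exact IH.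
Qed.

Lemma iter_shift G (Hs : list (fm G)) X (f : tm G (CTRL X)) u x s i :
  eqv Hs (ITER f u (SHAT (CONS x s)) (S' i)) (ITER f (STEP f u x) (SHAT s) i).
Proof.
  assert (H : prv T Hs (All TNat (Eq
    (ITER (wk _ f) (wk _ u) (SHAT (CONS (wk _ x) (wk _ s))) (S' v0))
    (ITER (wk _ f) (STEP (wk _ f) (wk _ u) (wk _ x)) (SHAT (wk _ s)) v0)))).
  2:{ spec H i. exact H. }
  nat_elim k IH.
  - rewrite iter_S, !iter_0, shat_0. reflexivity.
  - rewrite iter_S, IH, (iter_S _ _ _ _ (STEP f u x)), shat_S. reflexivity.
Qed.

(** Links finite plays to the process that the search examines, with the extension of [s] as the
    stream of answers. *)
Lemma iter_run G (Hs : list (fm G)) X (f : tm G (CTRL X)) u s :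
  eqv Hs (ITER f u (SHAT s) (LEN s)) (RUN f s u).
Proof.
  assert (H : prv T Hs (All (Seq X) (All (PT X)
    (Eq (ITER (wk _ (wk _ f)) v0 (SHAT v1) (LEN v1)) (RUN (wk _ (wk _ f)) v1 v0))))).
  2:{ spec H s. spec H u. exact H. }
  clear s u. seq_elim y s IH; all_intro u.
  - rewrite len_nil, iter_0, run_nil. reflexivity.
  - rewrite len_cons, iter_shift, run_cons. spec IH (STEP f u y). exact IH.
Qed.

Notation v5 := (Var (VS (VS (VS (VS (VS VZ)))))).
Notation BODY X R := (PT X ~> (X ~> R) ~> R).

(* The control need not decide whether the position is stopped: if it is below
   |s| then it is, and otherwise the body tests this itself. *)
Definition recT0 X R : tm [] (BODY X R ~> (PT X ~> R) ~> CTRL X ~> PT X ~> Seq X ~> R) :=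
  Lam (Lam (Lam (Lam (Con (BR X R)
    $ Lam (Lam (iteT $ ST v3 (RUN v3 v1 v2) $ (v4 $ RUN v3 v1 v2) $ (v5 $ RUN v3 v1 v2 $ v0)))
    $ Lam (v3 $ RUN v2 v0 v1)
    $ Lam (SEARCH v2 v1 v0 (Con Nil)))))).
Notation REC p b f u s := (closed (recT0 _ _) $ p $ b $ f $ u $ s).

Lemma rec_unfold G (Hs : list (fm G)) X R (p : tm G (BODY X R)) b f u s :
  eqv Hs (REC p b f u s) (Con (BR X R)
    $ Lam (Lam (iteT $ ST (wk _ (wk _ f)) (RUN (wk _ (wk _ f)) v1 (wk _ (wk _ u)))
        $ (wk _ (wk _ b) $ RUN (wk _ (wk _ f)) v1 (wk _ (wk _ u)))
        $ (wk _ (wk _ p) $ RUN (wk _ (wk _ f)) v1 (wk _ (wk _ u)) $ v0)))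
    $ Lam (wk _ b $ RUN (wk _ f) v0 (wk _ u))
    $ Lam (SEARCH (wk _ f) (wk _ u) v0 (Con Nil)) $ s).
Proof. unfold_closed (recT0 X R) recT0. bt. reflexivity. Qed.

Lemma rec_stop G (Hs : list (fm G)) X R (p : tm G (BODY X R)) b f u s :
  eqv Hs (ST f (RUN f s u)) One -> eqv Hs (REC p b f u s) (b $ RUN f s u).
Proof.
  intros H. rewrite rec_unfold. simp.
  dec_elim (monusT $ (S' SEARCH f u (SHAT s) (Con Nil)) $ LEN s) (O' : tm G TNat) L.
  - rewrite br_leaf; [bt; reflexivity|]. bt. exact L.
  - rewrite br_node; [bt; rewrite H; apply ite_S|].
    simp. imp_intro K. rewrite beta in K; simp_in K. exact (p_impE L K).
Qed.

Lemma rec_go G (Hs : list (fm G)) X R (p : tm G (BODY X R)) b f u s :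
  eqv Hs (ST f (RUN f s u)) O' -> eqv Hs (REC p b f u s)
    (p $ RUN f s u $ Lam (REC (wk _ p) (wk _ b) (wk _ f) (wk _ u) (SNOC (wk _ s) v0))).
Proof.
  intros H.
  dec_elim (monusT $ (S' SEARCH f u (SHAT s) (Con Nil)) $ LEN s) (O' : tm G TNat) L.
  - apply lt_ex in L. simp_in L. ex_elim L as d L.
    (* A control value below |s| names a stopped stage that the play has already passed, so the play
       is stuck at it. This contradicts [H] and excludes the leaf. *)
    assert (E : eqv Hs (ITER f u (SHAT s) (LEN s)) (ITER f u (SHAT s) (SEARCH f u (SHAT s) (Con Nil)))).
    { rewrite L. apply iter_stuck, search_stops. }
    rewrite iter_run in E. rewrite E in H. apply (zero_one H). apply search_stops.
  - etransitivity; [apply rec_unfold|]. simp. etransitivity; [apply br_node|].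
    + simp. imp_intro K. rewrite beta in K; simp_in K. exact (p_impE L K).
    + rewrite beta. simp. rewrite beta. simp. rewrite H, ite_0.
      apply eqv_app; [reflexivity|]. apply ext. intros D Ks x e W. push W.
      rewrite !beta. simp. rewrite rec_unfold. simp. reflexivity.
Qed.

(** * Uniqueness of solutions along plays, by symmetric bar induction *)

Definition solves {G X R} (p : tm G (BODY X R)) b f u (A : tm G (Seq X ~> R)) : fm G :=
  All (Seq X) (And
    (Imp (Eq (ST (wk _ f) (RUN (wk _ f) v0 (wk _ u))) One)
      (Eq (wk _ A $ v0) (wk _ b $ RUN (wk _ f) v0 (wk _ u))))
    (Imp (Eq (ST (wk _ f) (RUN (wk _ f) v0 (wk _ u))) O')
      (Eq (wk _ A $ v0) (wk _ p $ RUN (wk _ f) v0 (wk _ u) $ Lam (wk _ (wk _ A) $ SNOC v1 v0))))).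

Lemma fsub_solves G D X R (p : tm G (BODY X R)) b f u A (e : smap G D) :
  fsub (solves p b f u A) e = solves (sub p e) (sub b e) (sub f e) (sub u e) (sub A e).
Proof. unfold solves; simp. reflexivity. Qed.

Lemma solves_stop G (Hs : list (fm G)) X R (p : tm G (BODY X R)) b f u A s :
  prv T Hs (solves p b f u A) -> eqv Hs (ST f (RUN f s u)) One -> eqv Hs (A $ s) (b $ RUN f s u).
Proof. intros H E. unfold solves in H. simp_in H. spec H s. exact (p_impE (p_andL H) E). Qed.
Arguments solves_stop {G Hs X R p b f u A s}.

Lemma solves_go G (Hs : list (fm G)) X R (p : tm G (BODY X R)) b f u A s :
  prv T Hs (solves p b f u A) -> eqv Hs (ST f (RUN f s u)) O' ->
  eqv Hs (A $ s) (p $ RUN f s u $ Lam (wk _ A $ SNOC (wk _ s) v0)).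
Proof. intros H E. unfold solves in H. simp_in H. spec H s. simp. exact (p_impE (p_andR H) E). Qed.
Arguments solves_go {G Hs X R p b f u A s}.

(* w is the union of u and v, where u has priority. *)
Definition covers {G X} (u v w : tm G (PT X)) : fm G :=
  All TNat (And
    (Eq (DOM (wk _ w) v0) (iteT $ DOM (wk _ u) v0 $ One $ DOM (wk _ v) v0))
    (Eq (HAT (wk _ w) v0) (iteT $ DOM (wk _ u) v0 $ HAT (wk _ u) v0 $ HAT (wk _ v) v0))).

Lemma fsub_covers G D X (u v w : tm G (PT X)) (e : smap G D) :
  fsub (covers u v w) e = covers (sub u e) (sub v e) (sub w e).
Proof. unfold covers; simp. reflexivity. Qed.

Ltac sb_ext ::= match goal with
  | |- context [fsub (solves _ _ _ _ _) _] => rewrite fsub_solves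
  | |- context [fsub (covers _ _ _) _] => rewrite fsub_covers
  end.
Ltac sb_ext_in H ::= match type of H with
  | context [fsub (solves _ _ _ _ _) _] => rewrite fsub_solves in H
  | context [fsub (covers _ _ _) _] => rewrite fsub_covers in H
  end.

Lemma covers_dom G (Hs : list (fm G)) X (u v w : tm G (PT X)) k : prv T Hs (covers u v w) ->
  eqv Hs (DOM w k) (iteT $ DOM u k $ One $ DOM v k).
Proof. intros H. unfold covers in H. simp_in H. spec H k. exact (p_andL H). Qed.
Arguments covers_dom {G Hs X u v w k}.

Lemma covers_phat G (Hs : list (fm G)) X (u v w : tm G (PT X)) k : prv T Hs (covers u v w) ->
  eqv Hs (HAT w k) (iteT $ DOM u k $ HAT u k $ HAT v k).
Proof. intros H. unfold covers in H. simp_in H. spec H k. exact (p_andR H). Qed.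
Arguments covers_phat {G Hs X u v w k}.

Lemma covers_intro G (Hs : list (fm G)) X (u v w : tm G (PT X)) :
  prv T Hs (All TNat (Eq (DOM (wk _ w) v0) (iteT $ DOM (wk _ u) v0 $ One $ DOM (wk _ v) v0))) ->
  prv T Hs (All TNat (Eq (HAT (wk _ w) v0) (iteT $ DOM (wk _ u) v0 $ HAT (wk _ u) v0 $ HAT (wk _ v) v0))) ->
  prv T Hs (covers u v w).
Proof.
  intros H K. unfold covers. simp_in H. simp_in K. all_intro k. spec H k. spec K k. and_i; assumption.
Qed.

Lemma covers_nil G (Hs : list (fm G)) X (u : tm G (PT X)) : prv T Hs (covers u (Con Nil) u).
Proof.
  apply covers_intro; all_intro k; bit_elim u k E.
  - rewrite E, ite_0, dom_nil. reflexivity.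
  - rewrite E, ite_S. reflexivity.
  - rewrite E, ite_0, phat_nil. apply phat_undef, E.
  - rewrite E, ite_S. reflexivity.
Qed.

Lemma covers_undef G (Hs : list (fm G)) X (u v w : tm G (PT X)) k : prv T Hs (covers u v w) ->
  eqv Hs (DOM w k) O' -> prv T Hs (And (Eq (DOM u k) O') (Eq (DOM v k) O')).
Proof.
  intros H K. rewrite (covers_dom H) in K. bit_elim u k E.
  - rewrite E, ite_0 in K. and_i; assumption.
  - rewrite E, ite_S in K. apply (S_neq_0 K).
Qed.
Arguments covers_undef {G Hs X u v w k}.

(** If [u] is defined at [n], it overrides whatever [v] receives there, and [w] is unchanged. If
    only [v] is, both updates are void; otherwise both store [x]. *)
Lemma covers_upd G (Hs : list (fm G)) X (u v w : tm G (PT X)) n x :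
  prv T Hs (covers u v w) -> prv T Hs (covers u (UPD v n x) (UPD w n x)).
Proof.
  intros H. apply covers_intro; all_intro k; dec_elim k n E.
  - rewrite E, !dom_upd_same. bit_elim u n K; rewrite K; [rewrite ite_0|rewrite ite_S]; reflexivity.
  - rewrite !dom_upd_other by exact E. apply (covers_dom H).
  - rewrite E. bit_elim w n K.
    + pose proof (covers_undef H K) as L.
      pose proof (p_andL L : eqv Hs _ _) as L1. pose proof (p_andR L : eqv Hs _ _) as L2.
      rewrite !phat_upd_same by assumption. rewrite L1, ite_0. reflexivity.
    + rewrite upd_defined by exact K. rewrite (covers_phat H).
      rewrite (covers_dom H) in K. bit_elim u n L.
      * rewrite L, ite_0 in K. rewrite L, !ite_0. rewrite upd_defined by exact K. reflexivity.
      * rewrite L, !ite_S. reflexivity.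
  - rewrite !phat_upd_other by exact E. apply (covers_phat H).
Qed.

(** Comparing total extensions reduces the claim to pointwise equality, with no appeal to
    extensionality of codes; the control sees only the extension. *)
Lemma covers_phat_unique G (Hs : list (fm G)) X (u v w w' : tm G (PT X)) :
  prv T Hs (covers u v w) -> prv T Hs (covers u v w') -> eqv Hs (PHAT w) (PHAT w').
Proof.
  intros H H'. apply ext. intros D Ks k e W. push W.
  rewrite (covers_phat H), (covers_phat H'). reflexivity.
Qed.
Arguments covers_phat_unique {G Hs X u v w w'}.

(** The witness lets [u] override its argument before applying [f]. The existential hides it, so
    that eliminating it yields a variable of which only this property is known. *)
Lemma covers_ctrl G (Hs : list (fm G)) X (f : tm G (CTRL X)) (u : tm G (PT X)) :
  prv T Hs (Ex (CTRL X) (All (PT X) (All (PT X) (Imp (covers (wk _ (wk _ (wk _ u))) v1 v0)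
    (Eq (v2 $ PHAT v1) (wk _ (wk _ (wk _ f)) $ PHAT v0)))))).
Proof.
  ex (Lam (wk (TNat ~> X) f $ Lam (iteT $ DOM (wk _ (wk _ u)) v0 $ HAT (wk _ (wk _ u)) v0 $ (v1 $ v0)))).
  all_intro v. all_intro w. imp_intro H. bt. apply eqv_app; [reflexivity|].
  apply ext. intros D Ks k e W. push W. bt. symmetry. apply (covers_phat H).
Qed.

Lemma seg_0 G (Hs : list (fm G)) X (c : tm G (CTRL X)) a : eqv Hs (segT $ c $ a $ O') (Con Nil).
Proof. unfold segT. bt. apply rec_0. Qed.

Lemma seg_S G (Hs : list (fm G)) X (c : tm G (CTRL X)) a i :
  eqv Hs (segT $ c $ a $ (S' i))
    (STEP c (segT $ c $ a $ i) (a $ (c $ PHAT (segT $ c $ a $ i)))).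
Proof. unfold segT. bt. rewrite rec_S. bt. reflexivity. Qed.

Lemma covers_eqv G (Hs : list (fm G)) X (u v v' w w' : tm G (PT X)) :
  eqv Hs v v' -> eqv Hs w w' -> prv T Hs (covers u v w) -> prv T Hs (covers u v' w').
Proof.
  intros E F H. apply covers_intro; all_intro k; rewrite <- E, <- F.
  - apply (covers_dom H).
  - apply (covers_phat H).
Qed.

(** The process of [c] from the empty function, overlaid by [u], is the process of [f] from [u]: by
    the first premise both ask for the same position at every stage, and by the second [d] lists the
    answers of [a] in the order of asking. *)
Lemma covers_iter G (Hs : list (fm G)) X (f : tm G (CTRL X)) u c a d i :
  prv T Hs (All (PT X) (All (PT X) (Imp (covers (wk _ (wk _ u)) v1 v0)
    (Eq (wk _ (wk _ c) $ PHAT v1) (wk _ (wk _ f) $ PHAT v0))))) ->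
  prv T Hs (All TNat (Eq (wk _ d $ v0) (wk _ a $ (wk _ c $ PHAT (segT $ wk _ c $ wk _ a $ v0))))) ->
  prv T Hs (covers u (segT $ c $ a $ i) (ITER f u d i)).
Proof.
  intros C Hd. simp_in C. simp_in Hd.
  assert (H : prv T Hs (All TNat (covers (wk _ u) (segT $ wk _ c $ wk _ a $ v0)
        (ITER (wk _ f) (wk _ u) (wk _ d) v0)))).
  2:{ spec H i. exact H. }
  clear i. nat_elim i IH.
  - eapply covers_eqv; [symmetry; apply seg_0|symmetry; apply iter_0|]. apply covers_nil.
  - eapply covers_eqv; [symmetry; apply seg_S|symmetry; apply iter_S|].
    spec C (segT $ c $ a $ i). spec C (ITER f u d i). spec Hd i.
    pose proof (p_impE C IH : eqv Hs _ _) as E.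
    eapply covers_eqv; [reflexivity| |apply covers_upd, IH].
    rewrite E at 1. rewrite Hd. reflexivity.
Qed.

Lemma sBI_rule G (Hs : list (fm G)) X (P : fm (PT X :: G)) : prv T Hs (sBI_fm (X := X) P).
Proof. apply p_ax; left; right. apply (sBI_intro (X := X) P). Qed.

(** sBI begins at the empty function while the play begins at [u]; taking it for the control of
    [covers_ctrl] bridges this. The predicate says of [v] that the solutions agree at every play
    whose position is [v] overlaid by [u]. *)
Lemma solves_unique G (Hs : list (fm G)) X R (p : tm G (BODY X R)) b f u A B :
  prv T Hs (solves p b f u A) -> prv T Hs (solves p b f u B) ->
  eqv Hs (A $ Con Nil) (B $ Con Nil).
Proof.
  intros HA HB.
  pose proof (covers_ctrl _ Hs _ f u) as C. simp_in C. ex_elim C as c C.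
  pose (P := All (Seq X) (Imp (covers (wk _ (wk _ u)) v1 (RUN (wk _ (wk _ f)) v0 (wk _ (wk _ u))))
    (Eq (wk _ (wk _ A) $ v0) (wk _ (wk _ B) $ v0))) : fm (PT X :: G)).
  pose proof (sBI_rule _ Hs X P) as I. unfold sBI_fm, P in I. clear P. simp_in I. spec I c.
  assert (H : prv T Hs (All (Seq X) (Imp (covers (wk _ u) (Con Nil) (RUN (wk _ f) v0 (wk _ u)))
    (Eq (wk _ A $ v0) (wk _ B $ v0))))).
  { simp. apply (p_impE I). clear I. and_i.
    - all_intro a.
      assert (Hd : prv T Hs (Ex (TNat ~> X) (All TNat
        (Eq (v1 $ v0) (wk _ (wk _ a) $ (wk _ (wk _ c) $ PHAT (segT $ wk _ (wk _ c) $ wk _ (wk _ a) $ v0))))))).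
      { ex (Lam (wk _ a $ (wk _ c $ PHAT (segT $ wk _ c $ wk _ a $ v0)))).
        all_intro i. bt. reflexivity. }
      (* The answers are now a variable, so the search along them yields the stage that sBI asks
         for. *)
      simp_in Hd. ex_elim Hd as d Hd.
      pose proof (covers_iter _ Hs _ f u c a d (SEARCH f u d (Con Nil))) as K.
      simp_in K. specialize (K C Hd).
      pose proof (search_stops _ Hs _ f u d) as L.
      ex (SEARCH f u d (Con Nil)).
      all_intro s. imp_intro M.
      (* The play and the process at the found stage overlay the same function by [u], so they share
         domain and extension, and with them the stop test. *)
      assert (E : eqv Hs (ST f (RUN f s u)) One).
      { rewrite (covers_dom M), <- (covers_dom K).
        rewrite (covers_phat_unique M K). exact L. }
      rewrite (solves_stop HA E), (solves_stop HB E).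
      reflexivity.
    - all_intro v. imp_intro I. clear I. imp_intro IH. all_intro s. imp_intro M.
      bit_elim (RUN f s u) (f $ PHAT (RUN f s u)) E.
      2:{ rewrite (solves_stop HA E), (solves_stop HB E).
          reflexivity. }
      (* The bar induction extends [v] at the very position that the play fills next. *)
      assert (Q : eqv Hs (c $ PHAT v) (f $ PHAT (RUN f s u))).
      { spec C v. spec C (RUN f s u). exact (p_impE C M). }
      assert (U : prv T Hs (Neg (Eq (DOM v (c $ PHAT v)) One))).
      { imp_intro W1. rewrite Q in W1.
        pose proof (p_andR (covers_undef M E) : eqv Hs _ _) as V.
        apply (zero_one V W1). }
      simp_in U. pose proof (p_impE IH U) as J. clear IH U.
      etransitivity; [apply (solves_go HA E)|].
      etransitivity; [|symmetry; apply (solves_go HB E)].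
      apply eqv_app; [reflexivity|]. apply ext. intros D Ks x e W. push W. bt.
      spec J x. spec J (SNOC s x). apply (p_impE J).
      eapply covers_eqv; [|symmetry; apply run_snoc|apply covers_upd, M].
      rewrite Q. reflexivity. }
  spec H (@Con G (Seq X) Nil). apply (p_impE H).
  eapply covers_eqv; [reflexivity|symmetry; apply run_nil|apply covers_nil].
Qed.

(** As functions of the moves that follow, both sides solve the recursion from the position after
    [x], since [run_cons] identifies their positions. They are defined with different starting
    points and hence different controls, so uniqueness is needed. *)
Lemma rec_shift G (Hs : list (fm G)) X R (p : tm G (BODY X R)) b f u x :
  eqv Hs (REC p b f u (CONS x (Con Nil))) (REC p b f (STEP f u x) (Con Nil)).
Proof.
  pose proof (solves_unique _ Hs _ _ p b f (STEP f u x)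
    (Lam (REC (wk _ p) (wk _ b) (wk _ f) (wk _ u) (CONS (wk _ x) v0)))
    (closed (recT0 _ _) $ p $ b $ f $ (STEP f u x))) as H.
  rewrite beta in H. simp_in H. apply H; clear H; unfold solves; all_intro s; and_i; imp_intro E.
  - rewrite beta. simp. rewrite <- run_cons in E |- *. apply rec_stop, E.
  - rewrite beta. simp. rewrite <- run_cons in E |- *.
    etransitivity; [apply rec_go, E|]. apply eqv_app; [reflexivity|].
    apply ext. intros D Ks y e W. push W. bt. rewrite snoc_cons. reflexivity.
  - apply rec_stop, E.
  - pose proof (rec_go _ Hs _ _ p b f (STEP f u x) s) as Q. simp_in Q. exact (Q E).
Qed.

Theorem theorem5p2 (X R : ty) :
  exists Gamma : tm nil (BarRecTy (Part X) X R),
    provable EHA_sBI_BR (sBR_eqn Gamma).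
Proof.
  exists (Lam (Lam (Lam (Lam (REC v3 v2 v1 v0 (Con Nil)))))).
  (* The tactics transfer facts between named lists of hypotheses, so the empty list is replaced by
     a variable. *)
  unfold provable, sBR_eqn. generalize (@nil (fm [])). intros Hs.
  all_intro p. all_intro b. all_intro f. all_intro u.
  set (t := Lam _).
  assert (E : forall G (Hs : list (fm G)) p b f u,
    eqv Hs (closed t $ p $ b $ f $ u) (REC p b f u (Con Nil))).
  { clear. intros. unfold_closed t t. bt. reflexivity. }
  clearbody t. and_i; imp_intro N; rewrite E.
  - etransitivity; [apply rec_stop; rewrite run_nil; exact N|]. rewrite run_nil. reflexivity.
  - bit_elim u (f $ PHAT u) K; [|apply p_botE, (p_impE N K)].
    etransitivity; [apply rec_go; rewrite run_nil; exact K|]. rewrite run_nil.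
    apply eqv_app; [reflexivity|]. apply ext. intros D1 Ks x e W. push W. bt.
    (* The left side continues the old play by the single move [x]; the right side restarts from the
       updated position. *)
    rewrite E, snoc_nil. apply rec_shift.
Qed.
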